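(* Let $p \in (s_1, s_\infty)$ and let $r_1, r_2$ be real numbers with $s_1 \le r_1 < r_2 \le s_\infty$. Suppose that for each $i \in \{1,2\}$ there is a constant $C_i$ such that $$\operatorname{meas}\{x \in \mathbb X : |\mathfrak R_p \mathfrak f(x)| > t\} \le C_i\, t^{-r_i} \int_{\mathbb X} |\mathfrak f(x)|^{r_i}\, dx \quad \text{for all } t>0,$$ whenever $\mathfrak f \in \mathscr L^p(\mathbb X, \mathbb V) \cap \mathscr L^{r_i}(\mathbb X, \mathbb V)$. Then for every $r \in (r_1, r_2)$ there exists a constant $C_r$ such that $$\int_{\mathbb X} |\mathfrak R_p \mathfrak f(x)|^r\, dx \le C_r \int_{\mathbb X} |\mathfrak f(x)|^r\, dx$$ whenever $\mathfrak f \in \mathscr L^p(\mathbb X, \mathbb V) \cap \mathscr L^r(\mathbb X, \mathbb V)$.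
   Context: $(\mathbb X, dx)$ is a $\sigma$-finite measure space, $\mathbb V$ is a finite dimensional inner product space with norm $|\cdot|$, and $\mathscr L^s(\mathbb X,\mathbb V)$ is the usual Lebesgue space of (classes of) measurable functions $\mathbb X \to \mathbb V$. $\mathscr L^2_+(\mathbb X,\mathbb V)$ is a fixed closed subspace of $\mathscr L^2(\mathbb X,\mathbb V)$ and $\Pi : \mathscr L^2(\mathbb X,\mathbb V) \to \mathscr L^2_+(\mathbb X,\mathbb V)$ is the orthogonal projection onto it. For $s$ in an interval $(s_1,s_\infty)$, with fixed $1 \le s_1 < 2 < s_\infty \le \infty$, let $\mathscr L^s_+(\mathbb X,\mathbb V)$ denote the closure of $\mathscr L^2_+(\mathbb X,\mathbb V) \cap \mathscr L^s(\mathbb X,\mathbb V)$ in the norm of $\mathscr L^s(\mathbb X,\mathbb V)$. Standing assumption: for every $s \in (s_1,s_\infty)$, $\Pi$ extends (from $\mathscr L^2 \cap \mathscr L^s$) to a continuous linear operator from $\mathscr L^s(\mathbb X,\mathbb V)$ onto $\mathscr L^s_+(\mathbb X,\mathbb V)$. For $p \in (s_1,s_\infty)$, the (in general nonlinear) operator $\mathfrak R_p : \mathscr L^p(\mathbb X,\mathbb V) \to \mathscr L^p_+(\mathbb X,\mathbb V)$ is the $\mathscr L^p$-projection: $\mathfrak R_p\mathfrak f = \alpha$ is the unique element of $\mathscr L^p_+(\mathbb X,\mathbb V)$ closest to $\mathfrak f$ in $\mathscr L^p$-distance, i.e. $\int_{\mathbb X}|\mathfrak f-\alpha|^p\,dx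 = \min_{\gamma \in \mathscr L^p_+(\mathbb X,\mathbb V)} \int_{\mathbb X}|\mathfrak f-\gamma|^p\,dx$. *)

(* Defs.v *)
From HB Require Import structures.
From mathcomp Require Import all_boot all_order all_algebra.
From mathcomp Require Import complex.
From mathcomp Require Import all_classical all_reals all_analysis.

Set Implicit Arguments.
Unset Strict Implicit.
Unset Printing Implicit Defensive.

Import Order.TTheory GRing.Theory Num.Theory.
Import numFieldNormedType.Exports.

Local Open Scope classical_set_scope.
Local Open Scope ring_scope.

(* The value space is an inner product space over the reals or over the
   complex numbers; both cases are treated at once. *)
Variant scalar_kind := RealScalars | ComplexScalars.

Definition scalars (R : realType) (k : scalar_kind) : numFieldType :=
  match k with
  | RealScalars => (R : numFieldType)
  | ComplexScalars => (R[i] : numFieldType)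
  end.

Definition sconj (R : realType) (k : scalar_kind) :
    scalars R k -> scalars R k :=
  match k with
  | RealScalars => fun a => a
  | ComplexScalars => fun a => conjc a
  end.

Definition sRe (R : realType) (k : scalar_kind) : scalars R k -> R :=
  match k with
  | RealScalars => fun a => a
  | ComplexScalars => fun a => complex.Re a
  end.

Definition sIm (R : realType) (k : scalar_kind) : scalars R k -> R :=
  match k with
  | RealScalars => fun=> 0
  | ComplexScalars => fun a => complex.Im a
  end.

Section VectorValuedLebesgueSpaces.
Context {R : realType} {k : scalar_kind} {V : vectType (scalars R k)}.
Variable ip : {dot V for @sconj R k}.
Context {d : measure_display} {X : measurableType d}.
Variable mu : {measure set X -> \bar R}.

Implicit Types (f g h : X -> V) (s p : R) (A : set (X -> V)).

Definition vnorm (v : V) : R := Num.sqrt (sRe (ip v v)).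

(* All coordinates are measurable; the imaginary part of a functional phi is
   the real part of the functional - 'i phi, so real parts suffice.  As V is
   finite dimensional this is Borel measurability. *)
Definition vmeasurable f : Prop :=
  forall phi : {scalar V}, measurable_fun setT (fun x => sRe (phi (f x))).

(* Classes of functions are represented by functions: every notion below is
   invariant under measurable modification on a null set. *)
Definition Ls s : set (X -> V) :=
  [set f | vmeasurable f /\ finite_norm mu s%:E (vnorm \o f)].

Definition Ldist s f g : \bar R :=
  'N[mu]_(s%:E)[EFin \o (vnorm \o (f \- g))].

Definition Lclosure s A : set (X -> V) :=
  [set f | Ls s f /\
     forall e : R, 0 < e -> exists2 g, A g & (Ldist s f g < e%:E)%E].

Definition closed_subspace_L2 A : Prop :=
  [/\ A `<=` Ls 2,
      A (fun=> 0),
      (forall (a : scalars R k) f g, A f -> A g ->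
         A (fun x => a *: f x + g x)) &
      Lclosure 2 A `<=` A].

(* Vanishing of the scalar product of L^2, i.e. of the integral of ip (f x)
   (g x), expressed through its real and imaginary parts. *)
Definition L2orth f g : Prop :=
  \int[mu]_x sRe (ip (f x) (g x)) = 0 /\ \int[mu]_x sIm (ip (f x) (g x)) = 0.

Section Projections.
Variable L2p : set (X -> V).

(* g represents the orthogonal projection of f onto L2p. *)
Definition is_orth_proj f g : Prop :=
  L2p g /\ forall h, L2p h -> L2orth (f \- g) h.

Definition Lsp s : set (X -> V) := Lclosure s (L2p `&` Ls s).

(* The orthogonal projection extends from L^2 `&` L^s to a continuous linear
   operator P from L^s onto Lsp s.  Linearity is up to null sets; that P is
   well defined on classes follows from linearity and continuity. *)
Definition orth_proj_extends s : Prop :=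
  exists P : (X -> V) -> (X -> V),
  [/\ (forall (a : scalars R k) f g, Ls s f -> Ls s g ->
         P (fun x => a *: f x + g x) = (fun x => a *: P f x + P g x) %[ae mu]),
      (forall f, Ls s f -> forall e : R, 0 < e ->
         exists2 delta : R, 0 < delta &
           forall g, Ls s g -> (Ldist s g f < delta%:E)%E ->
             (Ldist s (P g) (P f) < e%:E)%E),
      (forall f, Ls s f -> Lsp s (P f)),
      (forall g, Lsp s g -> exists2 f, Ls s f & P f = g %[ae mu]) &
      (forall f, Ls 2 f -> Ls s f -> is_orth_proj f (P f))].

(* g represents the L^p-projection of f.  For 1 < p such a g is unique up to a
   null set, by strict convexity, and exists, by uniform convexity, so that
   this is the graph of the projection operator. *)
Definition is_Lp_proj p f g : Prop :=
  Lsp p g /\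
  forall h, Lsp p h ->
    (\int[mu]_x (vnorm (f x - g x) `^ p)%:E <=
     \int[mu]_x (vnorm (f x - h x) `^ p)%:E)%E.

End Projections.

End VectorValuedLebesgueSpaces.

(* Main.v *)
Require Import Defs.
From HB Require Import structures.
From mathcomp Require Import all_boot all_order all_algebra.
From mathcomp Require Import complex.
From mathcomp Require Import all_classical all_reals all_analysis.
From mathcomp Require Import measurable_realfun.
From mathcomp Require Import ring lra.

Set Implicit Arguments.
Unset Strict Implicit.
Unset Printing Implicit Defensive.

Import Order.TTheory GRing.Theory Num.Theory.
Import numFieldNormedType.Exports.

Local Open Scope classical_set_scope.
Local Open Scope ring_scope.

(** Write [a] for the [L^p]-projection of [f].  The projection is not
    sublinear, so that its values at the two halves of a splitting of [f] do not
    control its value at [f], and Marcinkiewicz's argument does not apply as it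
    stands.  What replaces sublinearity is stability under cutting: if [f'] is
    [f] set to zero on a set [A], with projection [a'], then the midpoint of [a]
    and [a'] competes with both projections, and uniform convexity of the [p]-th
    power of the norm leaves only an integral over [A]
    (lemma [proj_cut_stability]):

      int E (f - a, f' - a') <= eta int_A |f - a|^p + C int_A |f|^p,

    where [E] is the gap between the average of the [p]-th powers and the [p]-th
    power of the midpoint.  Here [eta] can be taken as small as desired.  The
    gap is at least a multiple of [t ^ p] wherever [|a| > 7 t] while [|a'|] and
    [|f|] are at most [t].

    This makes [p] itself serve as one endpoint of the interpolation; the other
    one is a weak type exponent [q] with [r] strictly between [p] and [q], namely
    [q = r1] if [r < p] and [q = r2] if [r > p].  The case
    [r = p] follows by comparing [a] with [0].  At level [t] the function is cut
    to zero where [max |f| |f - a|] is below [t] if [r < p], and above [t] if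
    [r > p].  The weak type estimate applies to the remaining part [f'], which is
    in [L^q].  Multiplied by [t ^ r] and summed over the dyadic levels, the
    bounds for the measure of [{|a| > 7 t}] add up to

      int |a|^r <= kappa int |f - a|^r + C int |f|^r

    (lemmas [sum_level_term_le] and [npow_proj_le_of_Lr]).  Because [f - a] takes
    part in the choice of the set, the first integral has the same exponent [r]
    as the left side, and it is absorbed there when [kappa] is small.

    The absorption needs [int |a|^r] to be finite.  That is clear if [f] is also
    in [L^q], since [a] is then in [L^p] and in weak [L^q].  A general [f] is cut
    once, at a level close to [0] or to infinity, and stability compares the
    distribution functions of the two projections
    (lemma [Lp_proj_strong_type]).

    The projections of the cut functions have to exist.  This is shown by a
    minimizing sequence, which is Cauchy by uniform convexity, and by
    completeness of [L^p] (lemmas [best_approximation_exists] and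
    [Lp_complete]). *)

(** * Powers of real numbers *)

Section ScalarInequalities.
Context {R : realType}.
Implicit Types (p q r a b c e m s t w x y : R).

Lemma powR_le r x y : 0 <= r -> 0 <= x -> x <= y -> x `^ r <= y `^ r.
Proof.
move=> r0 x0 xy; apply: ge0_ler_powR => //; rewrite nnegrE //.
exact: le_trans xy.
Qed.

Lemma sqr_le x y : 0 <= x -> x <= y -> x ^+ 2 <= y ^+ 2.
Proof. by move=> x0 xy; rewrite ler_sqr ?nnegrE//; exact: le_trans xy. Qed.

Lemma powRD_pos x r s : 0 < x -> x `^ (r + s) = x `^ r * x `^ s.
Proof. by move=> x0; rewrite powRD// (gt_eqF x0) implybT. Qed.

Lemma powR_subK x r s : 0 < x -> x `^ (r - s) * x `^ s = x `^ r.
Proof. by move=> x0; rewrite -powRD_pos// subrK. Qed.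

Lemma powRD_le2 r x y : 0 <= r -> 0 <= x -> 0 <= y ->
  (x + y) `^ r <= 2 `^ r * (x `^ r + y `^ r).
Proof.
move=> r0; wlog xy : x y / x <= y.
  move=> H x0 y0; have [xy|/ltW yx] := leP x y; first exact: H.
  by rewrite addrC [in leRHS]addrC; exact: H.
move=> x0 y0; apply: (@le_trans _ _ ((2 * y) `^ r)).
  by apply: powR_le => //; lra.
rewrite powRM//; apply: ler_wpM2l; first exact: powR_ge0.
by rewrite lerDr powR_ge0.
Qed.

(** Writing [1 + x = e ^ l], this combines [e ^ z > 1 + z] at [z = - l] and at
    [z = (p - 1) l]. *)
Lemma bernoulli_powR_lt p x : 1 < p -> 0 < 1 + x -> x != 0 ->
  1 + p * x < (1 + x) `^ p.
Proof.
move=> p1 x1 x0; set l := ln (1 + x).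
have le : expR l = 1 + x by rewrite lnK// posrE.
have l0 : l != 0.
  by apply: contra_neq x0 => l0; move: le; rewrite l0 expR0 => h; lra.
have -> : (1 + x) `^ p = expR l * expR ((p - 1) * l).
  by rewrite /powR gt_eqF// -expRD -/l; congr expR; ring.
have h1 : 1 + - l < expR (- l) by apply: expR_gt1Dx; rewrite oppr_eq0.
have h2 : 1 + (p - 1) * l < expR ((p - 1) * l).
  by apply: expR_gt1Dx; rewrite mulf_neq0// subr_eq0 gt_eqF.
have h3 : expR l * (1 - l) < 1.
  by rewrite -[ltRHS](expRxMexpNx_1 l) ltr_pM2l ?expR_gt0//.
have h4 : expR l * (1 + (p - 1) * l) < expR l * expR ((p - 1) * l).
  by rewrite ltr_pM2l ?expR_gt0//.
apply: lt_trans h4; rewrite le in h3 *.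
have h5 : 0 < p - 1 by rewrite subr_gt0.
nra.
Qed.

Lemma bernoulli_powR_le p x : 1 < p -> 0 <= 1 + x ->
  1 + p * x <= (1 + x) `^ p.
Proof.
move=> p1; rewrite le_eqVlt => /orP[/eqP x1|x1].
  by rewrite -x1 powR0 ?gt_eqF//; [have -> : x = -1 by lra|]; lra.
have [->|x0] := eqVneq x 0; last by rewrite ltW// bernoulli_powR_lt.
by rewrite mulr0 addr0 powR1.
Qed.

(** Uniform convexity of [x ^ p] on the half-line.  For
    [s = (1 + x) h] and [t = (1 - x) h] the gap is bounded below through the
    excess [(1 + x) ^ p - 1 - p x], which increases with [x >= 0]. *)
Lemma midpoint_powR_gap p d : 1 < p -> 0 < d -> exists2 c, 0 < c &
  forall s t, 0 <= s -> 0 <= t -> d * (s + t) <= `|s - t| ->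
    (1 + c) * ((s + t) / 2) `^ p <= (s `^ p + t `^ p) / 2.
Proof.
move=> p1 d0; pose c := ((1 + d) `^ p - 1 - p * d) / 2.
exists c => [|s t].
  have : 1 + p * d < (1 + d) `^ p by apply: bernoulli_powR_lt; lra.
  by rewrite /c => ?; lra.
wlog st : s t / t <= s.
  move=> H s0 t0; have [ts|/ltW ts] := leP t s; first exact: H.
  by rewrite distrC (addrC s) (addrC (s `^ p)); exact: H.
move=> s0 t0 ; rewrite ger0_norm ?subr_ge0// => hd.
have [h0|h0] := eqVneq (s + t) 0.
  have [-> ->] : s = 0 /\ t = 0 by split; lra.
  by rewrite addr0 mul0r !powR0 ?gt_eqF//; lra.
set h := (s + t) / 2.
have hpos : 0 < h by rewrite /h divr_gt0//; rewrite lt_def h0; lra.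
pose x := (s - t) / (s + t).
have dx : d <= x by rewrite /x ler_pdivlMr//; rewrite /h in hpos; lra.
have es : s = (1 + x) * h by rewrite /x /h; field.
have et : t = (1 - x) * h by rewrite /x /h; field.
have x1 : x <= 1 by rewrite /x ler_pdivrMr; rewrite /h in hpos; lra.
have e1 : s `^ p = (1 + x) `^ p * h `^ p by rewrite {1}es powRM//; lra.
have e2 : t `^ p = (1 - x) `^ p * h `^ p by rewrite {1}et powRM//; lra.
rewrite e1 e2 -mulrDl mulrAC; apply: ler_wpM2r; first exact: powR_ge0.
have b1 : 1 + p * (- x) <= (1 - x) `^ p by apply: bernoulli_powR_le; lra.
pose y := (x - d) / (1 + d).
have y0 : 0 <= y by rewrite /y divr_ge0//; lra.
have b2 : (1 + x) `^ p = (1 + d) `^ p * (1 + y) `^ p.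
  rewrite -powRM; [congr powR|lra|lra].
  by rewrite /y; field; lra.
have b3 : 1 + p * y <= (1 + y) `^ p by apply: bernoulli_powR_le; lra.
have b4 : 1 + d <= (1 + d) `^ p by apply: le1r_powR; lra.
have b5 : (1 + d) `^ p * (1 + p * y) <= (1 + x) `^ p.
  by rewrite b2 ler_wpM2l// powR_ge0.
have b6 : (1 + d) * y = x - d by rewrite /y; field; lra.
have b7 : (1 + d) * (p * y) <= (1 + d) `^ p * (p * y).
  by apply: ler_wpM2r => //; rewrite mulr_ge0//; lra.
rewrite /c; have : (1 + d) * (p * y) = p * (x - d) by rewrite -b6; ring.
lra.
Qed.

Lemma midpoint_powR p s t : 1 < p -> 0 <= s -> 0 <= t ->
  ((s + t) / 2) `^ p <= (s `^ p + t `^ p) / 2.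
Proof.
move=> p1 s0 t0.
have [h0|h0] := eqVneq (s + t) 0.
  have [-> ->] : s = 0 /\ t = 0 by split; lra.
  by rewrite addr0 mul0r powR0 ?gt_eqF//; lra.
set h := (s + t) / 2.
have hpos : 0 < h by rewrite /h divr_gt0//; rewrite lt_def h0; lra.
pose x := (s - t) / (s + t).
have es : s = (1 + x) * h by rewrite /x /h; field.
have et : t = (1 - x) * h by rewrite /x /h; field.
have x1 : x <= 1 by rewrite /x ler_pdivrMr; rewrite /h in hpos; lra.
have x2 : -1 <= x by rewrite /x ler_pdivlMr; rewrite /h in hpos; lra.
have -> : s `^ p = (1 + x) `^ p * h `^ p by rewrite {1}es powRM//; lra.
have -> : t `^ p = (1 - x) `^ p * h `^ p by rewrite {1}et powRM//; lra.
rewrite -mulrDl mulrAC -[leLHS]mul1r; apply: ler_wpM2r; first exact: powR_ge0.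
have b1 : 1 + p * (- x) <= (1 - x) `^ p by apply: bernoulli_powR_le; lra.
have b3 : 1 + p * x <= (1 + x) `^ p by apply: bernoulli_powR_le; lra.
lra.
Qed.

(** Uniform convexity of the [p]-th power of a Hilbert norm, read off the
    four lengths [s = |u|], [t = |v|], [w = |u - v|] and [m = |(u + v) / 2|].
    When [s] and [t] differ, the gap is that of the scalar function; when they
    are close, the parallelogram identity makes [m] smaller than their mean. *)
Lemma parallelogram_powR_gap p d : 1 < p -> 0 < d -> exists2 c, 0 < c &
  forall s t w m, 0 <= s -> 0 <= t -> 0 <= m -> 0 <= w ->
    m <= (s + t) / 2 -> m ^+ 2 + (w / 2) ^+ 2 = (s ^+ 2 + t ^+ 2) / 2 ->
    d * (s + t) <= w -> m `^ p + c * (s + t) `^ p <= (s `^ p + t `^ p) / 2.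
Proof.
move=> p1; wlog d1 : d / d <= 1.
  move=> H d0; have [d1|/ltW d1] := leP d 1; first exact: H.
  have [c c0 Hc] := H 1 (lexx _) ltr01; exists c => // s t w m *.
  apply: (Hc _ _ w) => //; apply: le_trans (_ : d * (s + t) <= _) => //.
  by apply: ler_wpM2r => //; exact: addr_ge0.
move=> d0; have p0 : 0 <= p by lra.
have d20 : 0 < d / 2 by lra.
have [c1 c10 Hc1] := midpoint_powR_gap p1 d20.
pose th := 1 - 3 * d ^+ 2 / 8.
have dd : 0 < d ^+ 2 <= 1 by rewrite exprn_gt0//= expr_le1// ltW.
have th0 : 0 <= th < 1 by rewrite /th; apply/andP; split; lra.
have thp : th `^ p < 1.
  have -> : 1 = 1 `^ p by rewrite powR1.
  by apply: gt0_ltr_powR; rewrite ?nnegrE; lra.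
have c2 : 0 < Num.min c1 (1 - th `^ p) by rewrite lt_min c10/=; lra.
exists (2^-1 `^ p * Num.min c1 (1 - th `^ p)) => [|s t w m s0 t0 m0 w0 ms par hw].
  by rewrite mulr_gt0// powR_gt0//; lra.
set c := Num.min _ _.
rewrite mulrAC -powRM//; last lra; rewrite (mulrC 2^-1).
set h := (s + t) / 2; rewrite -/h in ms.
have h0 : 0 <= h by rewrite /h; lra.
have hp0 : 0 <= h `^ p by exact: powR_ge0.
have [gap|close] := leP (d / 2 * (s + t)) `|s - t|.
  have := Hc1 _ _ s0 t0 gap; rewrite -/h.
  have : m `^ p <= h `^ p by exact: powR_le.
  have : h `^ p * c <= h `^ p * c1 by apply: ler_wpM2l => //; rewrite ge_min lexx.
  by rewrite -/h; lra.
have mth : m <= th * h.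
  rewrite -ler_sqr ?nnegrE//; last by rewrite mulr_ge0//; lra.
  have w2 : (d * (s + t)) ^+ 2 <= w ^+ 2.
    by apply: sqr_le => //; rewrite mulr_ge0//; lra.
  have st2 : (s - t) ^+ 2 <= (d / 2 * (s + t)) ^+ 2.
    rewrite -[leLHS]real_normK ?num_real//.
    by apply: sqr_le => //; exact: ltW.
  have : m ^+ 2 = h ^+ 2 + (s - t) ^+ 2 / 4 - w ^+ 2 / 4.
    by rewrite -[LHS](addrK ((w / 2) ^+ 2)) par /h; field.
  have hh : (s + t) ^+ 2 = 4 * h ^+ 2 by rewrite /h; field.
  have w2' : d ^+ 2 * (4 * h ^+ 2) <= w ^+ 2 by rewrite -hh -exprMn.
  have st2' : (s - t) ^+ 2 <= d ^+ 2 / 4 * (4 * h ^+ 2).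
    by rewrite -hh (_ : _ / 4 = (d / 2) ^+ 2) -?exprMn//; field.
  have h20 : 0 <= h ^+ 2 by exact: exprn_ge0.
  have : (1 - 3 * d ^+ 2 / 4) * h ^+ 2 <= th ^+ 2 * h ^+ 2.
    by apply: ler_wpM2r => //; rewrite /th; nra.
  have -> : (th * h) ^+ 2 = th ^+ 2 * h ^+ 2 by ring.
  move: w2' st2' h20; move: (h ^+ 2) (th ^+ 2) => H T.
  by move=> w2' st2' h20 HT ->; lra.
have mp : m `^ p <= th `^ p * h `^ p.
  by rewrite -powRM//; [exact: powR_le|lra].
have : h `^ p * c <= h `^ p * (1 - th `^ p).
  by apply: ler_wpM2l => //; rewrite ge_min lexx orbT.
have := midpoint_powR p1 s0 t0; rewrite -/h.
by rewrite -/h; lra.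
Qed.

(** A factor close to [1] in front of [m ^ p] is possible because [g] is either
    a small multiple of [m], or [m] is at most a large multiple of [g]. *)
Lemma powRD_le_eta p eta : 0 < p -> 0 < eta -> exists2 c, 0 <= c &
  forall m g : R, 0 <= m -> 0 <= g ->
    (m + g) `^ p <= (1 + eta) * m `^ p + c * g `^ p.
Proof.
move=> p0 e0; pose d := (1 + eta) `^ p^-1 - 1.
have d1 : (1 + d) `^ p = 1 + eta.
  by rewrite /d addrC subrK -powRrM mulVf ?gt_eqF// powRr1//; lra.
have d0 : 0 < d.
  have -> : d = (1 + eta) `^ p^-1 - 1 `^ p^-1 by rewrite powR1.
  by rewrite subr_gt0; apply: gt0_ltr_powR; rewrite ?nnegrE ?invr_gt0//; lra.
exists ((1 + d^-1) `^ p) => [|m g m0 g0]; first exact: powR_ge0.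
have [gm|mg] := leP g (d * m).
  apply: (@le_trans _ _ (((1 + d) * m) `^ p)).
    by apply: powR_le; lra.
  by rewrite powRM ?d1//; [rewrite lerDl mulr_ge0// powR_ge0|lra].
apply: (@le_trans _ _ (((1 + d^-1) * g) `^ p)).
  apply: powR_le; [lra|lra|].
  rewrite mulrDl mul1r (addrC m) lerD2l mulrC ler_pdivlMr// mulrC; exact: ltW.
have di : 0 < d^-1 by rewrite invr_gt0.
rewrite powRM//; last lra.
by rewrite lerDr mulr_ge0 ?powR_ge0//; lra.
Qed.

End ScalarInequalities.

(** * Sums over dyadic levels *)

Section DyadicSums.
Context {R : realType}.
Implicit Types (p q r a b c e t x : R).

(** The levels [t] on the side of [x] where [t ^ e] decreases away from [x], so
    that its sum over dyadic levels is at most a multiple of [x ^ e]. *)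
Definition summable_side e x t : bool := if e < 0 then x <= t else t < x.

Lemma summable_sideN e e' x t : (e' < 0) = ~~ (e < 0) ->
  summable_side e' x t = ~~ summable_side e x t.
Proof.
by rewrite /summable_side => ->; case: (e < 0); [rewrite ltNge|rewrite leNgt].
Qed.

Lemma sum_dyadic_powR e : e != 0 -> exists2 D, 0 <= D &
  forall N c x, 0 < c -> 0 < x ->
    \sum_(k < N) (c * 2 ^+ k) `^ e * (summable_side e x (c * 2 ^+ k))%:R
      <= D * x `^ e.
Proof.
move=> e0; rewrite /summable_side.
have two0 : 0 < 2 :> R by [].
have step c k : c * 2 ^+ k.+1 = c * 2 * 2 ^+ k by rewrite exprS; ring.
have [en|ep] := ltP e 0.
  have q1 : 2 `^ e < 1.
    by rewrite /powR pnatr_eq0/= expR_lt1 nmulr_rlt0// ln_gt0// ltr1n.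
  have D0 : 0 < (1 - 2 `^ e)^-1 by rewrite invr_gt0 subr_gt0.
  exists (1 - 2 `^ e)^-1 => [|N c x c0 x0]; first exact: ltW.
  set D := (1 - 2 `^ e)^-1 in D0 *.
  have Dq : D = 1 + D * 2 `^ e by rewrite /D; field; rewrite gt_eqF// subr_gt0.
  have mono u v : 0 < u -> u <= v -> v `^ e <= u `^ e.
    move=> u0 uv; have v0 : 0 < v by exact: lt_le_trans uv.
    rewrite -(opprK e) !(powRN _ (- e)) lef_pV2 ?posrE ?powR_gt0//.
    by apply: powR_le => //; [rewrite oppr_ge0|]; exact: ltW.
  (* With [max c x] in place of [x] the bound survives a change of the
     starting level [c], which is what the induction changes. *)
  suff : \sum_(k < N) (c * 2 ^+ k) `^ e * (x <= c * 2 ^+ k)%R%:R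
      <= D * (Num.max c x) `^ e.
    move=> /le_trans; apply; rewrite ler_wpM2l ?(ltW D0)//.
    by apply: mono => //; rewrite le_max lexx orbT.
  elim: N c c0 => [|N IH] c c0.
    by rewrite big_ord0 mulr_ge0 ?powR_ge0// ltW.
  rewrite big_ord_recl expr0 mulr1.
  under eq_bigr do rewrite step.
  have := IH _ (mulr_gt0 c0 two0); have [xc|cx] := leP x c.
    rewrite (max_l (_ : x <= c * 2)); last by lra.
    rewrite (powRM e (ltW c0) (ltW two0)) mulr1 => h.
    apply: le_trans (lerD (lexx _) h) _.
    rewrite [in leRHS]Dq; lra.
  rewrite mulr0 add0r => /le_trans; apply; apply: ler_wpM2l; first exact: ltW.
  by apply: mono => //; rewrite le_max lexx orbT.
have {e0}ep : 0 < e by rewrite lt_def e0.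
have q1 : 1 < 2 `^ e.
  by rewrite /powR pnatr_eq0/= expR_gt1 mulr_gt0// ln_gt0// ltr1n.
exists (2 `^ e / (2 `^ e - 1)) => [|N c x c0 x0].
  by rewrite divr_ge0 ?powR_ge0// subr_ge0 ltW.
set D := 2 `^ e / (2 `^ e - 1).
have D0 : 0 <= D by rewrite divr_ge0 ?powR_ge0// subr_ge0 ltW.
have Dq : D * 2 `^ e = D + 2 `^ e.
  by rewrite /D; field; rewrite gt_eqF// subr_gt0.
(* For [e > 0] the induction is on the last level, so the bound is capped
   there.  The factors [2] make room for one further level. *)
suff H : 2 `^ e * (\sum_(k < N) (c * 2 ^+ k) `^ e * (c * 2 ^+ k < x)%R%:R)
    <= D * (Num.min (2 * x) (c * 2 ^+ N)) `^ e.
  rewrite -(ler_pM2l (_ : 0 < 2 `^ e)) ?powR_gt0//.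
  apply: le_trans H _; rewrite mulrCA -powRM ?(ltW x0)//.
  rewrite ler_wpM2l// powR_le ?(ltW ep)//; last by rewrite ge_min lexx.
  by rewrite le_min !mulr_ge0 ?(ltW x0) ?(ltW c0)// exprn_ge0.
elim: N => [|N IH].
  by rewrite big_ord0 mulr0 mulr_ge0 ?powR_ge0.
rewrite big_ord_recr/= mulrDr.
have t0 : 0 < c * 2 ^+ N by rewrite mulr_gt0// exprn_gt0.
have -> : c * 2 ^+ N.+1 = 2 * (c * 2 ^+ N) by rewrite exprS; ring.
set t := c * 2 ^+ N in IH t0 *.
have m0 : 0 <= Num.min (2 * x) t by rewrite le_min; apply/andP; split; lra.
have [tx|xt] := ltP t x.
  rewrite (min_r (_ : 2 * t <= 2 * x)); last by lra.
  rewrite (min_r (_ : t <= 2 * x)) in IH; last by lra.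
  rewrite (powRM e (ltW two0) (ltW t0)).
  by rewrite mulr1 [in leRHS]mulrA Dq mulrDl lerD2r.
rewrite !mulr0 addr0; apply: le_trans IH _.
rewrite ler_wpM2l// powR_le ?(ltW ep)//.
by rewrite le_min; apply/andP; split; rewrite ge_min ?lexx//; apply/orP; right; lra.
Qed.

(** With [a = |f|] and [b = |f - R_p f|], the right side of the level estimates
    summed over all levels.  For [a <= delta b] both terms are homogeneous
    multiples of [b ^ r] with a small factor; otherwise everything is
    comparable to [a ^ r].  The order of the quantifiers matters: the constant
    [C] of the stability estimate depends on [eta]. *)
Lemma summed_levels_absorb p q r D kappa : 0 < p -> 0 < q -> 0 < r ->
  0 <= D -> 0 < kappa -> exists2 eta, 0 < eta & forall C, 0 <= C ->
  exists2 C', 0 <= C' & forall a b, 0 <= a -> 0 <= b ->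
    D * (Num.max a b) `^ (r - p) * (eta * b `^ p + C * a `^ p)
    + D * C * ((Num.max a b) `^ (r - q) * a `^ q)
      <= kappa * b `^ r + C' * a `^ r.
Proof.
move=> p0 q0 r0 D0 k0.
have D1 : 0 < 3 * (D + 1) by lra.
exists (kappa / (3 * (D + 1))) => [|C C0]; first exact: divr_gt0.
set eta := kappa / _; have eta0 : 0 <= eta by rewrite divr_ge0// ltW.
have De : D * eta <= kappa / 3.
  have -> : kappa / 3 = (D + 1) * eta by rewrite /eta; field; lra.
  by nra.
have [dl [dl0 dl1 dlp dlq]] : exists dl, [/\ 0 < dl, dl <= 1,
    D * C * dl `^ p <= kappa / 3 & D * C * dl `^ q <= kappa / 3].
  have DC0 : 0 <= D * C by exact: mulr_ge0.
  pose k := Num.min 1 (kappa / (3 * (D * C + 1))).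
  have k1 : 0 < k by rewrite lt_min ltr01/= divr_gt0//; lra.
  have kp s : 0 < s -> (k `^ s^-1) `^ s = k.
    by move=> s0; rewrite -powRrM mulVf ?gt_eqF// powRr1// ltW.
  have k3 : D * C * k <= kappa / 3.
    have h : k * (3 * (D * C + 1)) <= kappa.
      by rewrite -ler_pdivlMr; [rewrite /k ge_min lexx orbT|lra].
    nra.
  have kle s : k `^ s^-1 >= 0 by exact: powR_ge0.
  exists (Num.min 1 (Num.min (k `^ p^-1) (k `^ q^-1))); split.
  - by rewrite !lt_min ltr01 !powR_gt0.
  - by rewrite ge_min lexx.
  - apply: le_trans (_ : D * C * k <= _) => //; apply: ler_wpM2l => //.
    rewrite -[leRHS](kp p)// powR_le ?(ltW p0)//.
      by rewrite !le_min ler01 !kle.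
    by rewrite !ge_min lexx !orbT.
  - apply: le_trans (_ : D * C * k <= _) => //; apply: ler_wpM2l => //.
    rewrite -[leRHS](kp q)// powR_le ?(ltW q0)//.
      by rewrite !le_min ler01 !kle.
    by rewrite !ge_min lexx !orbT.
pose K e := 1 + (dl^-1) `^ e.
have K0 e : 0 <= K e by rewrite /K addr_ge0 ?powR_ge0.
have C'0 : 0 <= D * K (r - p) * (eta * dl^-1 `^ p + C) + D * C * K (r - q).
  by apply: addr_ge0; rewrite !mulr_ge0// addr_ge0// mulr_ge0 ?powR_ge0.
exists (D * K (r - p) * (eta * (dl^-1) `^ p + C) + D * C * K (r - q)).
  exact: C'0.
move=> a b a0 b0; have [ab|ba] := leP a (dl * b).
  have ab' : a <= b by nra.
  rewrite max_r//.
  have [bz|bz] := eqVneq b 0.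
    have -> : a = 0 by move: ab; rewrite bz mulr0; lra.
    have z s : 0 < s -> (0 : R) `^ s = 0 by move=> s0; rewrite powR0// gt_eqF.
    by rewrite bz (z _ p0) (z _ q0) (z _ r0) !(mulr0, addr0).
  have bp : 0 < b by rewrite lt_def bz.
  have ap s : 0 < s -> a `^ s <= dl `^ s * b `^ s.
    by move=> s0; rewrite -powRM//; [apply: powR_le => //|]; exact: ltW.
  have t1 : D * b `^ (r - p) * (eta * b `^ p + C * a `^ p) <=
      (D * eta + D * C * dl `^ p) * b `^ r.
    rewrite -[in leRHS](powR_subK r p bp) -mulrA mulrDl.
    have -> : D * eta * (b `^ (r - p) * b `^ p) + D * C * dl `^ p *
       (b `^ (r - p) * b `^ p) = D * (b `^ (r - p) *
        (eta * b `^ p + C * (dl `^ p * b `^ p))) by ring.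
    apply: ler_wpM2l => //; apply: ler_wpM2l; first exact: powR_ge0.
    by rewrite lerD2l; apply: ler_wpM2l => //; exact: ap.
  have t2 : D * C * (b `^ (r - q) * a `^ q) <= D * C * dl `^ q * b `^ r.
    rewrite -[in leRHS](powR_subK r q bp).
    have -> : D * C * dl `^ q * (b `^ (r - q) * b `^ q) =
      D * C * (b `^ (r - q) * (dl `^ q * b `^ q)) by ring.
    apply: ler_wpM2l; first exact: mulr_ge0.
    by apply: ler_wpM2l; [exact: powR_ge0|exact: ap].
  apply: le_trans (lerD t1 t2) _; rewrite -mulrDl.
  rewrite -[leLHS]addr0; apply: lerD.
    by apply: ler_wpM2r; [exact: powR_ge0|lra].
  by apply: mulr_ge0; last exact: powR_ge0.
have ap : 0 < a by apply: le_lt_trans ba; rewrite mulr_ge0// ltW.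
have ba' : b <= dl^-1 * a by rewrite mulrC ler_pdivlMr// mulrC ltW.
have di : 1 <= dl^-1 by rewrite invf_ge1.
set M := Num.max a b.
have aM : a <= M by rewrite /M le_max lexx.
have Ma : M <= dl^-1 * a by rewrite /M ge_max ba' andbT; nra.
have ME e : M `^ e <= K e * a `^ e.
  rewrite /K mulrDl mul1r -powRM ?(ltW ap)//; last by lra.
  have [e0|e0] := leP 0 e.
    apply: le_trans (powR_le e0 _ Ma) _; first by lra.
    by rewrite lerDr powR_ge0.
  apply: (@le_trans _ _ (a `^ e)); last by rewrite lerDl powR_ge0.
  rewrite -(opprK e) !(powRN _ (- e)) lef_pV2 ?posrE ?powR_gt0//; last by lra.
  by apply: powR_le => //; lra.
have bp : b `^ p <= (dl^-1) `^ p * a `^ p.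
  by rewrite -powRM ?(ltW ap)//; [apply: powR_le => //; lra|lra].
have t1 : D * M `^ (r - p) * (eta * b `^ p + C * a `^ p) <=
    D * K (r - p) * (eta * (dl^-1) `^ p + C) * a `^ r.
  rewrite -[in leRHS](powR_subK r p ap).
  have -> : D * K (r - p) * (eta * dl^-1 `^ p + C) * (a `^ (r - p) * a `^ p) =
    D * (K (r - p) * a `^ (r - p)) * ((eta * dl^-1 `^ p + C) * a `^ p) by ring.
  apply: ler_pM => //.
  - by rewrite mulr_ge0// powR_ge0.
  - by apply: addr_ge0; apply: mulr_ge0; rewrite ?powR_ge0.
  - exact: ler_wpM2l.
  - by rewrite mulrDl lerD2r -mulrA ler_wpM2l.
have t2 : D * C * (M `^ (r - q) * a `^ q) <= D * C * K (r - q) * a `^ r.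
  rewrite -[in leRHS](powR_subK r q ap).
  have -> : D * C * K (r - q) * (a `^ (r - q) * a `^ q) =
    D * C * (K (r - q) * a `^ (r - q) * a `^ q) by ring.
  apply: ler_wpM2l; first exact: mulr_ge0.
  by apply: ler_wpM2r; [exact: powR_ge0|].
apply: le_trans (lerD t1 t2) _.
by rewrite -mulrDl lerDr mulr_ge0 ?powR_ge0// ltW.
Qed.

Lemma exists_div_expn2_lt (a e : R) : 0 < e -> exists n, a / 2 ^+ n < e.
Proof.
move=> e0; have [a0|a0] := leP a 0.
  by exists 0%N; rewrite expr0 divr1 (le_lt_trans a0).
have [n Hn] : exists n : nat, a / e < n%:R.
  by exists (Num.truncn (a / e)).+1; rewrite truncnS_gt.
exists n; rewrite ltr_pdivrMr ?exprn_gt0// -ltr_pdivrMl// mulrC.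
by apply: lt_le_trans Hn _; rewrite -natrX ler_nat ltnW// ltn_expl.
Qed.

Lemma sum_dyadic_above r : 0 < r -> exists2 D, 0 <= D &
  forall N c a, 0 < c -> 0 <= a ->
    \sum_(k < N) (c * 2 ^+ k) `^ r * (c * 2 ^+ k < a)%R%:R <= D * a `^ r.
Proof.
move=> r0; have [D D0 HD] := sum_dyadic_powR (lt0r_neq0 r0).
exists D => // N c a c0 a0; have [a00|a1] := eqVneq a 0.
  rewrite big1 => [|k _]; first by rewrite mulr_ge0 ?powR_ge0.
  by rewrite a00 ltNge ltW ?mulr0// mulr_gt0// exprn_gt0.
have ap : 0 < a by rewrite lt_def a1.
by have := HD N c a c0 ap; rewrite /summable_side (ltNge r 0) (ltW r0).
Qed.

(** The bound for [t ^ r] times the measure of [{|R_p f| > 7 t}], with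
    [a = |f|] and [b = |f - R_p f|]: the weak type [(q, q)] estimate is used on
    one side of [max a b = t], and stability of the projection on the other. *)
Definition level_term p q r Cq eta C a b t : R :=
  Cq * (t `^ (r - q) * ((~~ summable_side (r - p) (Num.max a b) t)%:R * a `^ q))
  + t `^ r * (t < a)%R%:R
  + t `^ (r - p) * ((summable_side (r - p) (Num.max a b) t)%:R *
                    (eta * b `^ p + C * a `^ p)).

Lemma sum_level_term_le p q r Cq kappa : 0 < p -> 0 < q -> 0 < r ->
  r - p != 0 -> r - q != 0 -> (r - q < 0) = ~~ (r - p < 0) ->
  0 <= Cq -> 0 < kappa ->
  exists2 eta, 0 < eta & forall C, 0 <= C -> exists2 C', 0 <= C' &
  forall N c a b, 0 < c -> 0 <= a -> 0 <= b ->
    \sum_(k < N) level_term p q r Cq eta C a b (c * 2 ^+ k)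
      <= kappa * b `^ r + C' * a `^ r.
Proof.
move=> p0 q0 r0 rp rq opp Cq0 k0.
have [D1 D10 H1] := sum_dyadic_powR rq.
have [D2 D20 H2] := sum_dyadic_above r0.
have [D3 D30 H3] := sum_dyadic_powR rp.
have D0 : 0 <= D1 + D3 by exact: addr_ge0.
have [eta eta0 Heta] := summed_levels_absorb p0 q0 r0 D0 k0.
exists eta => // C C0; have [C' C'0 HC'] := Heta (C + Cq) (addr_ge0 C0 Cq0).
exists (C' + D2) => [|N c a b c0 a0 b0]; first exact: addr_ge0.
have z s : 0 < s -> (0 : R) `^ s = 0 by move=> s0; rewrite powR0// gt_eqF.
have t0 k : 0 < c * 2 ^+ k by rewrite mulr_gt0// exprn_gt0.
have [M0|M0] := leP (Num.max a b) 0.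
  have [a00 b00] : a = 0 /\ b = 0.
    by move: M0; rewrite ge_max => /andP[a1 b1]; split; apply/le_anti/andP.
  rewrite big1 => [|k _].
    by rewrite addr_ge0 ?mulr_ge0 ?powR_ge0 ?addr_ge0// ltW.
  rewrite /level_term a00 b00 (z _ p0) (z _ q0) (ltNge _ 0) (ltW (t0 k))/=.
  by rewrite !(mulr0, addr0).
have second : \sum_(k < N) (c * 2 ^+ k) `^ r * (c * 2 ^+ k < a)%R%:R <= D2 * a `^ r.
  exact: H2.
set M := Num.max a b in M0 *; set E := eta * b `^ p + C * a `^ p.
have E0 : 0 <= E by rewrite addr_ge0 ?mulr_ge0 ?powR_ge0// ltW.
have first : \sum_(k < N) Cq * ((c * 2 ^+ k) `^ (r - q) *
    ((~~ summable_side (r - p) M (c * 2 ^+ k))%:R * a `^ q)) <=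
    D1 * Cq * (M `^ (r - q) * a `^ q).
  have -> : D1 * Cq * (M `^ (r - q) * a `^ q) = Cq * a `^ q * (D1 * M `^ (r - q)).
    by ring.
  apply: le_trans (ler_wpM2l _ (H1 N c M c0 M0)); last by rewrite mulr_ge0 ?powR_ge0.
  rewrite mulr_sumr le_eqVlt; apply/orP; left; apply/eqP/eq_bigr => k _.
  by rewrite -(summable_sideN _ _ opp); ring.
have third : \sum_(k < N) (c * 2 ^+ k) `^ (r - p) *
    ((summable_side (r - p) M (c * 2 ^+ k))%:R * E) <= D3 * M `^ (r - p) * E.
  apply: le_trans (ler_wpM2r E0 (H3 N c M c0 M0)).
  rewrite mulr_suml le_eqVlt; apply/orP; left; apply/eqP/eq_bigr => k _.
  by rewrite mulrA.
rewrite /level_term !big_split/= -/M -/E.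
apply: le_trans (lerD (lerD first second) third) _.
have := HC' a b a0 b0; rewrite -/M mulrDl.
have := powR_ge0 M (r - p); have := powR_ge0 M (r - q).
have := powR_ge0 a q; have := powR_ge0 a p; rewrite -/E.
have EE : E <= eta * b `^ p + (C + Cq) * a `^ p.
  by rewrite /E lerD2l ler_wpM2r ?powR_ge0// lerDl.
move: EE E0; move: (eta * _ + _) => F; clearbody E.
move: (a `^ p) (a `^ q) (M `^ (r - p)) (M `^ (r - q)) => A B P Q EF E0 A0 B0 Q0 P0 HF.
rewrite mulrDl; apply: le_trans (_ : (D1 + D3) * P * F +
  (D1 + D3) * (C + Cq) * (Q * B) + D2 * a `^ r <= _); last first.
  by rewrite addrA lerD2r; move: HF; rewrite !mulrDl.
rewrite [leLHS]addrAC lerD2r addrC; apply: lerD.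
  apply: ler_pM => //; first by rewrite mulr_ge0.
  by apply: ler_wpM2r => //; rewrite lerDr.
apply: ler_wpM2r; first by rewrite mulr_ge0.
by apply: ler_pM => //; rewrite ?lerDl ?lerDr.
Qed.

End DyadicSums.

(** * The value space as a real inner product space *)

Section Scalars.
Context {R : realType} {k : scalar_kind}.
Implicit Types (x : R) (a b : scalars R k).

Definition sreal : R -> scalars R k :=
  match k with
  | RealScalars => fun x => x
  | ComplexScalars => fun x => x%:C%C
  end.

(** The imaginary unit, with [0] in the real case, so that both cases share
    the decomposition [a = Re a + i Im a]. *)
Definition sI : scalars R k :=
  match k with
  | RealScalars => 0
  | ComplexScalars => 'i%C
  end.

Lemma sRe0 : sRe (0 : scalars R k) = 0. Proof. by case: k. Qed.

Lemma sReD a b : sRe (a + b) = sRe a + sRe b.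
Proof. by case: k a b => // -[a b] [c d]. Qed.

Lemma sReN a : sRe (- a) = - sRe a.
Proof. by case: k a => // -[a b]. Qed.

Lemma sRe_conj a : sRe (sconj a) = sRe a.
Proof. by case: k a => // -[a b]. Qed.

Lemma sconjK a : sconj (sconj a) = a.
Proof. by case: k a => // -[a b]; rewrite /sconj/= opprK. Qed.

Lemma sRe_sreal x a : sRe (sreal x * a) = x * sRe a.
Proof.
rewrite /sreal; case: k a => // -[a b]; rewrite /sRe/=; simpc.
by rewrite ?mul0r ?subr0.
Qed.

Lemma sRe_conjI a : sRe (sconj sI * a) = sIm a.
Proof.
rewrite /sI; case: k a => [a|[a b]]; rewrite /sRe /sconj /sIm /=; first by rewrite mul0r.
by rewrite mul0r sub0r mulN1r opprK.
Qed.

Lemma scalar_decomp a : a = sreal (sRe a) + sreal (sIm a) * sI.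
Proof.
rewrite /sI /sreal; case: k a => [a|[a b]]; rewrite /sRe /sIm /=.
  by rewrite mulr0 addr0.
by simpc; rewrite ?(mulr0, mul0r, mulr1, subr0, addr0, add0r).
Qed.

Lemma sRe_gt0 a : 0 < a -> 0 < sRe a.
Proof.
rewrite /sRe; case: k a => // -[a b] /=.
by rewrite ltcE/= => /andP[_ ?].
Qed.

Lemma sreal_half (V : lmodType (scalars R k)) (v : V) :
  sreal 2^-1 *: (v + v) = v.
Proof.
rewrite -[v + v]mulr2n -(scaler_nat 2 v) scalerA (_ : _ * _ = 1) ?scale1r//.
rewrite /sreal; case: k => [|] /=; first by field.
by rewrite -(rmorph_nat (@real_complex R) 2) -rmorphM mulVf// rmorph1.
Qed.

End Scalars.

Section InnerProduct.
Context {R : realType} {k : scalar_kind} {V : vectType (scalars R k)}.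
Variable ip : {dot V for @sconj R k}.
Implicit Types (u v w : V) (x : R).

(** The real part of the scalar product is a real scalar product with the
    same norm; only it is used from here on. *)
Definition rip u v : R := sRe (ip u v).

Local Notation "`[ u ]" := (vnorm ip u) (format "`[ u ]").

Lemma ipC u v : ip u v = sconj (ip v u).
Proof. by rewrite (hermitian_subproof (s := ip)) expr0 mul1r. Qed.

Lemma ripC u v : rip u v = rip v u.
Proof. by rewrite /rip ipC sRe_conj. Qed.

Lemma ripDl u v w : rip (u + v) w = rip u w + rip v w.
Proof. by rewrite /rip linearDl sReD. Qed.

Lemma ripDr u v w : rip w (u + v) = rip w u + rip w v.
Proof. by rewrite !(ripC w) ripDl. Qed.

Lemma ripNl u w : rip (- u) w = - rip u w.
Proof. by rewrite /rip linearNl sReN. Qed.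

Lemma ripNr u w : rip w (- u) = - rip w u.
Proof. by rewrite !(ripC w) ripNl. Qed.

Lemma rip0l w : rip 0 w = 0.
Proof. by rewrite /rip linear0l sRe0. Qed.

Lemma ripZl x u w : rip (sreal x *: u) w = x * rip u w.
Proof. by rewrite /rip linearZl_LR /= sRe_sreal. Qed.

Lemma ripZr x u w : rip w (sreal x *: u) = x * rip w u.
Proof. by rewrite !(ripC w) ripZl. Qed.

Lemma rip_sumr (I : finType) (F : I -> V) w :
  rip w (\sum_i F i) = \sum_i rip w (F i).
Proof.
by apply: (big_morph (rip w)) => [u v|]; rewrite ?ripDr// ripC rip0l.
Qed.

Lemma rip_gt0 u : u != 0 -> 0 < rip u u.
Proof. by move=> u0; apply: sRe_gt0; exact: (neq0_dnorm_gt0 (s := ip)). Qed.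

Lemma rip_ge0 u : 0 <= rip u u.
Proof.
by have [->|u0] := eqVneq u 0; [rewrite rip0l|rewrite ltW// rip_gt0].
Qed.

Lemma vnorm_ge0 u : 0 <= `[u].
Proof. exact: sqrtr_ge0. Qed.

Lemma sqr_vnorm u : `[u] ^+ 2 = rip u u.
Proof. by rewrite sqr_sqrtr// rip_ge0. Qed.

Lemma vnorm0 : `[0] = 0.
Proof. by rewrite /vnorm -/(rip 0 0) rip0l sqrtr0. Qed.

Lemma vnormN u : `[- u] = `[u].
Proof. by rewrite /vnorm -!/(rip _ _) ripNl ripNr opprK. Qed.

Lemma vnormZ x u : `[sreal x *: u] = `|x| * `[u].
Proof.
rewrite /vnorm -!/(rip _ _) ripZl ripZr mulrA -expr2 sqrtrM ?sqr_ge0//.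
by rewrite sqrtr_sqr.
Qed.

Lemma vdistC u v : `[u - v] = `[v - u].
Proof. by rewrite -vnormN opprB. Qed.

Lemma vnorm_parallelogram u v :
  `[u + v] ^+ 2 + `[u - v] ^+ 2 = 2 * (`[u] ^+ 2 + `[v] ^+ 2).
Proof.
by rewrite !sqr_vnorm !(ripDl, ripDr, ripNl, ripNr) (ripC v u); ring.
Qed.

Lemma rip_le_vnorm u v : rip u v <= `[u] * `[v].
Proof.
have [->|v0] := eqVneq v 0; first by rewrite ripC rip0l vnorm0 mulr0.
have vv := rip_gt0 v0; set t := rip u v / rip v v.
have := rip_ge0 (u - sreal t *: v).
rewrite !(ripDl, ripDr, ripNl, ripNr, ripZl, ripZr) (ripC v u) => h.
have {}h : rip u v ^+ 2 <= rip u u * rip v v.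
  have e : t * rip v v = rip u v by rewrite /t divfK ?gt_eqF.
  have : 0 <= (rip u u - t * rip u v) * rip v v.
    by rewrite mulr_ge0 ?rip_ge0//; move: h; rewrite e; lra.
  by rewrite mulrBl mulrAC e subr_ge0 expr2.
apply: le_trans (ler_norm _) _; rewrite -sqrtr_sqr -sqrtrM ?rip_ge0//.
exact: ler_wsqrtr.
Qed.

Lemma ler_vnormD u v : `[u + v] <= `[u] + `[v].
Proof.
rewrite -ler_sqr ?nnegrE ?addr_ge0 ?vnorm_ge0// sqrrD !sqr_vnorm.
rewrite !(ripDl, ripDr) (ripC v u).
have := rip_le_vnorm u v; lra.
Qed.

Lemma ler_vnormB u v : `[u - v] <= `[u] + `[v].
Proof. by rewrite -(vnormN v); exact: ler_vnormD. Qed.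

Lemma norm_rip_le u v : `|rip u v| <= `[u] * `[v].
Proof.
rewrite ler_norml rip_le_vnorm andbT lerNl -ripNl -(vnormN u).
exact: rip_le_vnorm.
Qed.

Lemma ler_vnorm_sum (I : finType) (F : I -> V) :
  `[\sum_i F i] <= \sum_i `[F i].
Proof.
elim/big_ind2 : _ => [|x u y v xu yv|//]; first by rewrite vnorm0.
by apply: le_trans (ler_vnormD _ _) _; exact: lerD.
Qed.

(** The Gram matrix of a basis is invertible, so that every coordinate is the
    scalar product with some vector. *)
Lemma coord_ip : exists u : 'I_(\dim {:V}) -> V,
  forall v, v = \sum_i ip v (u i) *: (vbasis {:V})`_i.
Proof.
set n := \dim _; pose e i : V := (vbasis {:V})`_i.
have ve v : v = \sum_(i < n) coord (vbasis {:V}) i v *: e i.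
  exact: coord_vbasis (memvf v).
pose G : 'M[scalars R k]_n := \matrix_(i, j) ip (e i) (e j).
have Gu : G \in unitmx.
  rewrite -row_free_unit -kermx_eq0; apply/rowV0P => c /sub_kermxP cG.
  pose w := \sum_(i < n) c 0 i *: e i.
  have w0 : w = 0.
    apply/eqP/negPn/negP => /(neq0_dnorm_gt0 (s := ip)).
    rewrite {2}/w linear_sumr/= big1 ?ltxx// => j _.
    rewrite linearZr_LR/= (_ : ip w (e j) = 0) ?mulr0//.
    have : (c *m G) 0 j = 0 by rewrite cG mxE.
    rewrite mxE => <-; rewrite /w linear_sumlz; apply: eq_bigr => i _.
    by rewrite linearZl_LR/= !mxE.
  apply/rowP => i; rewrite mxE.
  have /freeP := basis_free (vbasisP {:V}); apply.
  exact: w0.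
exists (fun i => \sum_(j < n) sconj (invmx G j i) *: e j) => v.
rewrite {1}(ve v); apply: eq_bigr => i _; congr (_ *: _).
pose c : 'rV[scalars R k]_n := \row_i coord (vbasis {:V}) i v.
have -> : coord (vbasis {:V}) i v = (c *m G *m invmx G) 0 i.
  by rewrite mulmxK// mxE.
rewrite mxE linear_sumr; apply: eq_bigr => j _.
rewrite linearZr_LR/= sconjK mulrC; congr (_ * _).
rewrite mxE [in RHS](ve v) linear_sumlz; apply: eq_bigr => l _.
by rewrite linearZl_LR/= !mxE.
Qed.

(** With the multiples [sI *: e] of the basis vectors [e] added, real
    coefficients suffice, also over the complex numbers.  Measurability,
    representation of functionals and completeness are all read off from here. *)
Lemma real_frame : exists (n : nat) (w g : 'I_n -> V),
  forall v, v = \sum_i sreal (rip v (w i)) *: g i.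
Proof.
have [u Hu] := coord_ip; set n := \dim _ in u Hu.
pose e i : V := (vbasis {:V})`_i.
exists (n + n)%N.
exists (fun i => match fintype.split i with inl j => u j | inr j => sI *: u j end).
exists (fun i => match fintype.split i with inl j => e j | inr j => sI *: e j end).
move=> v; rewrite big_split_ord/= {1}(Hu v) -big_split/=.
apply: eq_bigr => i _.
rewrite (unsplitK (inl i : 'I_n + 'I_n)) (unsplitK (inr i : 'I_n + 'I_n)).
rewrite {1}(scalar_decomp (ip v (u i))) scalerDl scalerA.
by rewrite /rip linearZr_LR/= sRe_conjI.
Qed.

(** Riesz representation of the real part of a functional. *)
Lemma functional_rip (phi : {scalar V}) :
  exists w, forall v, sRe (phi v) = rip v w.
Proof.
have [n [w [g H]]] := real_frame.
exists (\sum_i sreal (sRe (phi (g i))) *: w i) => v.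
rewrite {1}(H v) linear_sum/= rip_sumr.
rewrite (big_morph (@sRe R k) sReD sRe0); apply: eq_bigr => i _.
by rewrite linearZ/= sRe_sreal ripZr mulrC.
Qed.

(** In finite dimension weak and norm convergence agree, which reduces
    completeness of [V] to that of the real numbers. *)
Lemma weak_cvg_vnorm (s : nat -> V) :
  (forall w, cvgn (fun n => rip (s n) w)) ->
  exists l, (fun n => `[s n - l]) @ \oo --> (0 : R).
Proof.
move=> cs; have [m [w [g H]]] := real_frame.
pose x i := limn (fun n => rip (s n) (w i)).
pose l := \sum_i sreal (x i) *: g i.
exists l.
have bd n : `[s n - l] <= \sum_i `|rip (s n) (w i) - x i| * `[g i].
  rewrite {1}(H (s n)) /l -sumrB; apply: le_trans (ler_vnorm_sum _) _.
  apply: ler_sum => i _; rewrite -scalerBl -vnormZ.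
  have -> : sreal (rip (s n) (w i)) - sreal (x i) =
            sreal (rip (s n) (w i) - x i) :> scalars R k.
    rewrite /sreal; case: k => //=; apply/eqP; rewrite eq_complex/=.
    by rewrite subrr !eqxx.
  by [].
apply: (@squeeze_cvgr _ _ _ _ (fun=> 0) (fun n => \sum_i `|rip (s n) (w i) - x i| * `[g i])).
- by near=> n; rewrite vnorm_ge0 bd.
- exact: cvg_cst.
- have c0 i : (fun n => `|rip (s n) (w i) - x i| * `[g i]) @ \oo --> (0 : R).
    rewrite -(mul0r `[g i]) -(normr0 R) -(subrr (x i)).
    apply: cvgMr_tmp; apply: cvg_norm.
    by apply: cvgB; [exact: cs|exact: cvg_cst].
  have /(_ (index_enum _) _ (fun=> 0) _ (fun i _ => c0 i)) :=
    @cvg_big R 'I_m +%R 0 xpredT (@add_continuous _) nat \oo.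
  by rewrite big1.
Unshelve. all: by end_near.
Qed.

Lemma vnorm_uniform_convexity p e : 1 < p -> 0 < e -> exists2 c, 0 < c &
  forall u v, e * (`[u] + `[v]) <= `[u - v] ->
    `[sreal 2^-1 *: (u + v)] `^ p + c * (`[u] + `[v]) `^ p
      <= (`[u] `^ p + `[v] `^ p) / 2.
Proof.
move=> p1 e0; have [c c0 H] := parallelogram_powR_gap p1 e0.
exists c => // u v; apply: H; rewrite ?vnorm_ge0//.
  rewrite vnormZ ger0_norm; last by lra.
  have := ler_vnormD u v; lra.
have := vnorm_parallelogram u v.
by rewrite vnormZ ger0_norm; [|lra]; lra.
Qed.

End InnerProduct.

(** * Measurability and integrability *)

Section RealIntegrals.
Context {d : measure_display} {X : measurableType d} {R : realType}.
Variable mu : {measure set X -> \bar R}.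
Implicit Types (g h : X -> R) (A B : X -> bool) (t : R).

Local Notation integrable h := (mu.-integrable setT (EFin \o h)).

Lemma integrable_dominated g h : measurable_fun setT g ->
  (forall x, 0 <= g x <= h x) -> integrable h -> integrable g.
Proof.
move=> mg gh ih; apply: le_integrable ih => //; first exact/measurable_EFinP.
move=> x _; have /andP[g0 ghx] := gh x; rewrite /= lee_fin.
by rewrite !ger0_norm// (le_trans g0).
Qed.

Lemma integrable_EFinD g h : integrable g -> integrable h ->
  integrable (fun x => g x + h x).
Proof. by move=> ig ih; have := integrableD measurableT ig ih. Qed.

Lemma integrable_EFinZ a h : integrable h -> integrable (fun x => a * h x).
Proof. by move=> ih; have := integrableZl measurableT a ih. Qed.

Lemma integrable_EFin_sum N (h : nat -> X -> R) :
  (forall i, integrable (h i)) -> integrable (fun x => \sum_(i < N) h i x).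
Proof.
move=> ih; elim: N => [|N IH].
  under eq_fun do rewrite big_ord0; exact: integrable0.
under eq_fun do rewrite big_ord_recr/=.
exact: integrable_EFinD.
Qed.

Lemma Rintegral_sum N (h : nat -> X -> R) : (forall i, integrable (h i)) ->
  \int[mu]_x (\sum_(i < N) h i x) = \sum_(i < N) \int[mu]_x h i x.
Proof.
move=> ih; elim: N => [|N IH].
  rewrite big_ord0; under eq_Rintegral do rewrite big_ord0.
  by rewrite Rintegral_cst// mul0r.
rewrite big_ord_recr/= -IH -RintegralD//.
  by apply: eq_Rintegral => x _; rewrite big_ord_recr.
exact: integrable_EFin_sum.
Qed.

Lemma Rintegral_le g h : integrable g -> integrable h ->
  (forall x, g x <= h x) -> \int[mu]_x g x <= \int[mu]_x h x.
Proof. by move=> ig ih gh; apply: le_Rintegral. Qed.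

Lemma integral_EFinE h : integrable h ->
  (\int[mu]_x (h x)%:E)%E = (\int[mu]_x h x)%:E.
Proof. by move=> ih; rewrite /Rintegral fineK//; exact: integrable_fin_num. Qed.

Lemma integrable_ge0P h : measurable_fun setT h -> (forall x, 0 <= h x) ->
  integrable h <-> (\int[mu]_x (h x)%:E < +oo)%E.
Proof.
move=> mh h0.
have e : (\int[mu]_x `|(EFin \o h) x|)%E = (\int[mu]_x (h x)%:E)%E.
  by apply: eq_integral => x _ /=; rewrite ger0_norm.
split=> [/integrableP[_]|hoo]; first by rewrite e.
by apply/integrableP; split; [exact/measurable_EFinP|rewrite e].
Qed.

Lemma measurable_indb A : measurable_fun setT A ->
  measurable_fun setT (fun x => (A x)%:R : R).
Proof.
move=> mA; rewrite (_ : (fun x => _) = fun x => if A x then 1 else 0).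
  exact: measurable_fun_ifT.
by apply/funext => x; case: (A x).
Qed.

Lemma measurable_mul_indb A h : measurable_fun setT A -> measurable_fun setT h ->
  measurable_fun setT (fun x => (A x)%:R * h x).
Proof. by move=> mA mh; apply: measurable_funM => //; exact: measurable_indb. Qed.

Lemma integrable_mul_indb A h : measurable_fun setT A -> (forall x, 0 <= h x) ->
  integrable h -> integrable (fun x => (A x)%:R * h x).
Proof.
move=> mA h0 ih; have /integrableP[/measurable_EFinP mh _] := ih.
apply: integrable_dominated ih; first exact: measurable_mul_indb.
by move=> x; case: (A x); rewrite ?mul1r ?mul0r ?lexx h0.
Qed.

Lemma measure_Rintegral A : measurable_fun setT A ->
  integrable (fun x => (A x)%:R) ->
  mu [set x | A x] = (\int[mu]_x (A x)%:R)%:E.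
Proof.
move=> mA iA; rewrite -integral_EFinE//.
have mS : measurable [set x | A x].
  by have := mA measurableT [set true] I; rewrite setTI.
rewrite -(setIT [set x | A x]) -integral_indic//; apply: eq_integral => x _.
rewrite indicE; case: (boolP (A x)) => Ax; first by rewrite mem_set.
by rewrite memNset//; exact/negP.
Qed.

End RealIntegrals.

Section VectorFunctions.
Context {R : realType} {k : scalar_kind} {V : vectType (scalars R k)}.
Variable ip : {dot V for @sconj R k}.
Context {d : measure_display} {X : measurableType d}.
Variable mu : {measure set X -> \bar R}.
Implicit Types (f g h : X -> V) (p : R).

Local Notation "`[ u ]" := (vnorm ip u) (format "`[ u ]").
Local Notation rip := (rip ip).
Local Notation integrable h := (mu.-integrable setT (EFin \o h)).

Lemma vmeasurableP f :
  vmeasurable f <-> forall w, measurable_fun setT (fun x => rip (f x) w).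
Proof.
split=> [mf w|mf phi].
  exact: (mf (applyr ip w)).
have [w Hw] := functional_rip ip phi.
under eq_fun do rewrite Hw; exact: mf.
Qed.

Lemma vmeasurableD f g : vmeasurable f -> vmeasurable g ->
  vmeasurable (fun x => f x + g x).
Proof.
move=> /vmeasurableP mf /vmeasurableP mg; apply/vmeasurableP => w.
under eq_fun do rewrite ripDl; exact: measurable_funD.
Qed.

Lemma vmeasurableZ a f : vmeasurable f -> vmeasurable (fun x => sreal a *: f x).
Proof.
move=> /vmeasurableP mf; apply/vmeasurableP => w.
under eq_fun do rewrite ripZl; exact: measurable_funM.
Qed.

Lemma vmeasurableB f g : vmeasurable f -> vmeasurable g ->
  vmeasurable (fun x => f x - g x).
Proof.
move=> /vmeasurableP mf /vmeasurableP mg; apply/vmeasurableP => w.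
under eq_fun do rewrite ripDl ripNl; exact: measurable_funB.
Qed.

Definition cut (A : X -> bool) f : X -> V := fun x => if A x then 0 else f x.

Lemma vmeasurable_cut A f : measurable_fun setT A -> vmeasurable f ->
  vmeasurable (cut A f).
Proof.
move=> mA /vmeasurableP mf; apply/vmeasurableP => w.
rewrite (_ : (fun x => _) = fun x => if A x then 0 else rip (f x) w).
  exact: measurable_fun_ifT.
by apply/funext => x; rewrite /cut; case: (A x); rewrite ?rip0l.
Qed.

Lemma measurable_vnorm f : vmeasurable f -> measurable_fun setT (fun x => `[f x]).
Proof.
move=> /vmeasurableP mf; have [n [w [g H]]] := real_frame ip.
rewrite (_ : (fun x => _) = fun x =>
    Num.sqrt (\sum_(i < n) rip (f x) (w i) * rip (f x) (g i))).
  apply: measurableT_comp; last first.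
    by apply: measurable_sum => i; apply: measurable_funM.
  by apply: continuous_measurable_fun => x; exact: sqrt_continuous.
apply/funext => x; rewrite /vnorm -/(rip (f x) (f x)); congr Num.sqrt.
rewrite {2}(H (f x)) rip_sumr; apply: eq_bigr => i _.
by rewrite ripZr.
Qed.

Lemma measurable_vnorm_powR p f : vmeasurable f ->
  measurable_fun setT (fun x => `[f x] `^ p).
Proof.
move=> mf; exact: measurableT_comp (measurable_powR p) (measurable_vnorm mf).
Qed.

Lemma poweR_Lnorm_vnorm p f : p != 0 ->
  ('N[mu]_(p%:E)[EFin \o (vnorm ip \o f)] `^ p)%E =
  (\int[mu]_x (`[f x] `^ p)%:E)%E.
Proof.
move=> p0; rewrite (powR_Lnorm mu _ p0); apply: eq_integral => x _ /=.
by rewrite ger0_norm ?vnorm_ge0.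
Qed.

Lemma LsP p f : 0 < p ->
  Ls ip mu p f <-> vmeasurable f /\ integrable (fun x => `[f x] `^ p).
Proof.
move=> p0; rewrite /Ls/= /finite_norm.
suff H : vmeasurable f -> (('N[mu]_(p%:E)[EFin \o (vnorm ip \o f)] < +oo)%E <->
    integrable (fun x => `[f x] `^ p)).
  by split=> -[mf h]; split=> //; apply/H.
move=> mf; rewrite integrable_ge0P; last 2 first.
- exact: measurable_vnorm_powR.
- by move=> x; exact: powR_ge0.
rewrite -poweR_Lnorm_vnorm ?gt_eqF//.
have := Lnorm_ge0 mu p%:E (EFin \o (vnorm ip \o f)).
case: ('N[mu]_(p%:E)[_])%E => //= [r _|_].
  by rewrite !ltry.
by rewrite gt_eqF// ltxx.
Qed.

Lemma Ldist_ltP p f g e : 0 < p -> 0 < e ->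
  Ls ip mu p (fun x => f x - g x) ->
  (Ldist ip mu p f g < e%:E)%E <-> \int[mu]_x (`[f x - g x] `^ p) < e `^ p.
Proof.
move=> p0 e0 /(LsP _ p0)[mf fi].
rewrite -lte_fin -integral_EFinE// -(@poweR_Lnorm_vnorm _ (f \- g)) ?gt_eqF//.
rewrite /Ldist.
have := Lnorm_ge0 mu p%:E (EFin \o (vnorm ip \o (f \- g))).
case: ('N[mu]_(p%:E)[_])%E => //= [r r0|_].
  rewrite !lte_fin; rewrite lee_fin in r0; split=> h.
    by apply: gt0_ltr_powR; rewrite ?nnegrE ?(ltW e0).
  rewrite ltNge; apply/negP => /(powR_le (ltW p0) (ltW e0)).
  by rewrite leNgt h.
by rewrite gt_eqF.
Qed.

Lemma LsD p f g : 0 < p -> Ls ip mu p f -> Ls ip mu p g ->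
  Ls ip mu p (fun x => f x + g x).
Proof.
move=> p0 /(LsP _ p0)[mf fi] /(LsP _ p0)[mg gi]; apply/(LsP _ p0).
split; first exact: vmeasurableD.
apply: integrable_dominated (integrable_EFinZ (2 `^ p) (integrable_EFinD fi gi)).
  by apply: measurable_vnorm_powR; exact: vmeasurableD.
move=> x; rewrite powR_ge0/=.
apply: le_trans (powRD_le2 (ltW p0) (vnorm_ge0 _ _) (vnorm_ge0 _ _)).
by apply: powR_le; rewrite ?(ltW p0) ?vnorm_ge0 ?ler_vnormD.
Qed.

Lemma LsZ p a f : 0 < p -> Ls ip mu p f -> Ls ip mu p (fun x => sreal a *: f x).
Proof.
move=> p0 /(LsP _ p0)[mf fi]; apply/(LsP _ p0).
split; first exact: vmeasurableZ.
rewrite (_ : (fun x => _) = fun x => `|a| `^ p * `[f x] `^ p).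
  exact: integrable_EFinZ.
by apply/funext => x; rewrite vnormZ powRM ?vnorm_ge0.
Qed.

Lemma LsB p f g : 0 < p -> Ls ip mu p f -> Ls ip mu p g ->
  Ls ip mu p (fun x => f x - g x).
Proof.
move=> p0 Lf Lg; have := LsD p0 Lf (LsZ (-1) p0 Lg).
rewrite (_ : (fun x => f x - g x) = fun x => f x + sreal (-1) *: g x)//.
apply/funext => x; congr (_ + _).
by rewrite /sreal; case: k V (g x) => V' v; rewrite ?rmorphN1 scaleN1r.
Qed.

Lemma Ls_cut p A f : 0 < p -> measurable_fun setT A -> Ls ip mu p f ->
  Ls ip mu p (cut A f).
Proof.
move=> p0 mA /(LsP _ p0)[mf fi]; apply/(LsP _ p0).
split; first exact: vmeasurable_cut.
apply: integrable_dominated fi.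
  by apply: measurable_vnorm_powR; exact: vmeasurable_cut.
move=> x; rewrite powR_ge0/= /cut; case: (A x) => //.
by rewrite vnorm0 powR0 ?gt_eqF ?powR_ge0.
Qed.

End VectorFunctions.

(** * Completeness of [L^p] *)

Section Completeness.
Context {R : realType} {k : scalar_kind} {V : vectType (scalars R k)}.
Variable ip : {dot V for @sconj R k}.

Local Notation "`[ u ]" := (vnorm ip u) (format "`[ u ]").
Local Notation rip := (rip ip).

Lemma geometric_steps_cvgn (a : nat -> R) K : 0 <= K ->
  (forall n, `|a n.+1 - a n| <= K / 2 ^+ n) -> cvgn a.
Proof.
move=> K0 ha; have -> : a = fun n => a 0%N + series (telescope a) n.
  by apply/funext => n; rewrite -eq_sum_telescope.
apply: is_cvgD; first exact: is_cvg_cst.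
apply: normed_cvg; apply: (@series_le_cvg _ _ (geometric K 2^-1)).
- by move=> n; exact: normr_ge0.
- by move=> n; rewrite /geometric/= mulr_ge0// exprn_ge0// invr_ge0.
- by move=> n; rewrite /telescope /geometric/= exprVn; exact: ha.
- by apply: is_cvg_geometric_series; rewrite ger0_norm; lra.
Qed.

Lemma geometric_steps_dist (s : nat -> V) K n m : 0 <= K ->
  (forall n, `[s n.+1 - s n] <= K / 2 ^+ n) ->
  `[s (n + m)%N - s n] <= 2 * K / 2 ^+ n - 2 * K / 2 ^+ (n + m).
Proof.
move=> K0 hs; elim: m => [|m IH]; first by rewrite addn0 !subrr vnorm0.
have -> : s (n + m.+1)%N - s n =
    (s (n + m).+1 - s (n + m)%N) + (s (n + m)%N - s n).
  by rewrite addnS addrA subrK.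
apply: le_trans (ler_vnormD _ _ _) _.
apply: le_trans (lerD (hs _) IH) _.
rewrite addnS exprS [2 * 2 ^+ _]mulrC invfM !mulrA.
have p0 : 0 < 2 ^+ (n + m) :> R by rewrite exprn_gt0.
set y := 2 ^+ (n + m) in p0 *; set z := 2 * K / 2 ^+ n.
have -> : 2 * K / y / 2 = K / y by field; rewrite gt_eqF.
have -> : 2 * K / y = K / y + K / y by field; rewrite gt_eqF.
lra.
Qed.

Lemma geometric_steps_limit (s : nat -> V) K : 0 <= K ->
  (forall n, `[s n.+1 - s n] <= K / 2 ^+ n) ->
  exists l, (fun n => `[s n - l]) @ \oo --> (0 : R).
Proof.
move=> K0 hs; apply: weak_cvg_vnorm => w.
apply: (@geometric_steps_cvgn _ (K * `[w])) => [|n].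
  by rewrite mulr_ge0// vnorm_ge0.
rewrite -ripNl -ripDl; apply: le_trans (norm_rip_le _ _ _) _.
by rewrite mulrAC; apply: ler_wpM2r => //; exact: vnorm_ge0.
Qed.

Lemma geometric_steps_limit_dist (s : nat -> V) K l n : 0 <= K ->
  (forall n, `[s n.+1 - s n] <= K / 2 ^+ n) ->
  (fun n => `[s n - l]) @ \oo --> (0 : R) -> `[l - s n] <= 2 * K / 2 ^+ n.
Proof.
move=> K0 hs sl; apply/ler_addgt0Pr => e e0.
have /cvgrPdist_lt/(_ _ e0)[N _ HN] := sl.
have := HN (n + N)%N (leq_addl _ _); rewrite /= sub0r normrN ger0_norm ?vnorm_ge0//.
move=> h; rewrite -(subrK (s (n + N)%N) l) -addrA.
apply: le_trans (ler_vnormD _ _ _) _; rewrite vdistC.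
have := geometric_steps_dist n N K0 hs.
have : 0 <= 2 * K / 2 ^+ (n + N) by rewrite !mulr_ge0// invr_ge0 exprn_ge0.
lra.
Qed.

Context {d : measure_display} {X : measurableType d}.
Variable mu : {measure set X -> \bar R}.

(** Completeness of [L^p].  With [F] the sum of the [2 ^ (n p) |h_(n+1) - h_n|^p],
    the sequence [h_n x] converges geometrically wherever [F x] is finite, and
    [|g - h_n| ^ p <= 2 ^ p 2 ^ (- n p) F] holds everywhere, trivially so where
    [F] is infinite. *)
Lemma Lp_complete p (h : nat -> X -> V) : 0 < p ->
  (forall n, Ls ip mu p (h n)) ->
  (forall n, \int[mu]_x (`[h n.+1 x - h n x] `^ p) <=
     1 / (2 ^ n.+1)%:R / (2 ^+ n) `^ p) ->
  exists2 g, Ls ip mu p g & forall n,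
    \int[mu]_x (`[g x - h n x] `^ p) <= (2 / 2 ^+ n) `^ p.
Proof.
move=> p0 Lh hd.
have pw0 n : 0 < (2 ^+ n) `^ p :> R by rewrite powR_gt0// exprn_gt0.
have Ld n : Ls ip mu p (fun x => h n.+1 x - h n x) by exact: LsB.
pose a n x : R := (2 ^+ n) `^ p * `[h n.+1 x - h n x] `^ p.
have a0 n x : 0 <= a n x by rewrite mulr_ge0 ?powR_ge0.
have ia n : mu.-integrable setT (EFin \o a n).
  by apply: integrable_EFinZ; have /LsP[] := Ld n.
have ma n : measurable_fun setT (a n).
  by have /integrableP[/measurable_EFinP] := ia n.
pose F x : \bar R := (\sum_(0 <= n <oo) (a n x)%:E)%E.
have F0 x : (0 <= F x)%E by apply: nneseries_ge0 => n _ _; rewrite lee_fin.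
have mF : measurable_fun setT F.
  have := @ge0_emeasurable_sum _ X R setT (fun n x => (a n x)%:E) xpredT.
  by apply=> [n x _ _|n _]; [rewrite lee_fin|exact/measurable_EFinP].
have iF : (\int[mu]_x F x <= 1)%E.
  rewrite integral_nneseries//; [|by move=> n; exact/measurable_EFinP|by move=> n x _; rewrite lee_fin].
  have eps := @epsilon_trick0 R 1 xpredT ler01.
  apply: le_trans eps.
  apply: lee_nneseries => [n _ _|n _].
    by apply: integral_ge0 => x _; rewrite lee_fin.
  rewrite integral_EFinE// lee_fin RintegralZl//; last by have /LsP[] := Ld n.
  by rewrite mulrC -ler_pdivlMr//; exact: hd.
pose D x : bool := (F x < +oo)%E.
have mD : measurable_fun setT D by exact: measurable_fun_lte.
pose K x : R := fine (F x) `^ p^-1.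
have step x n : D x -> `[h n.+1 x - h n x] <= K x / 2 ^+ n.
  move=> Dx; rewrite ler_pdivlMr ?exprn_gt0//.
  have Ff : F x \is a fin_num by rewrite ge0_fin_numE.
  have : a n x <= fine (F x).
    rewrite -lee_fin fineK//.
    have := @nneseries_lim_ge R (fun n => (a n x)%:E) xpredT 0 n.+1.
    move=> /(_ (fun _ _ _ => a0 _ _)); apply: le_trans.
    rewrite big_nat_recr//= leeDr// sume_ge0// => i _.
    by rewrite lee_fin.
  rewrite /a -powRM ?vnorm_ge0 ?exprn_ge0// => /(powR_le (_ : 0 <= p^-1)).
  rewrite invr_ge0 (ltW p0) powR_ge0 -powRrM mulfV ?gt_eqF// powRr1.
    by rewrite mulrC; exact.
  by rewrite mulr_ge0 ?vnorm_ge0 ?exprn_ge0.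
have K0 x : 0 <= K x by exact: powR_ge0.
pose hD n := cut (fun x => ~~ D x) (h n).
have hDin n x : D x -> hD n x = h n x by rewrite /hD /cut => ->.
pose P x := [set l | (fun n => `[hD n x - l]) @ \oo --> (0 : R)].
have Pex x : exists l, P x l.
  case: (boolP (D x)) => Dx.
    have [l Hl] := geometric_steps_limit (K0 x) (fun n => step x n Dx).
    by exists l; rewrite /P/=; under eq_fun do rewrite hDin//; exact: Hl.
  exists 0; rewrite /P/= /hD /cut Dx.
  by under eq_fun do rewrite subr0 vnorm0; exact: cvg_cst.
pose g x := xget 0 (P x).
have gP x : P x (g x) by apply: xgetPex; exact: Pex.
have mhD n : vmeasurable (hD n).
  have [mh _] := (LsP ip mu (h n) p0).1 (Lh n); apply: vmeasurable_cut => //.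
  exact: measurable_neg.
have mg : vmeasurable g.
  apply/(vmeasurableP ip) => w.
  apply: (measurable_fun_cvg (h := fun n x => rip (hD n x) w)).
    by move=> n; have /(vmeasurableP ip) := mhD n.
  move=> x _; apply/cvgrPdist_le => e e0.
  have e1 : 0 < e / (`[w] + 1) by rewrite divr_gt0// ltr_wpDl ?vnorm_ge0.
  have /cvgrPdist_lt/(_ _ e1) := gP x; apply: filterS => n /=.
  rewrite sub0r normrN ger0_norm ?vnorm_ge0// => h1.
  rewrite -ripNl -ripDl; apply: le_trans (norm_rip_le _ _ _) _.
  rewrite vdistC; move: h1; rewrite ltr_pdivlMr ?ltr_wpDl ?vnorm_ge0// => h1.
  by apply: le_trans (ltW h1); rewrite mulrDr mulr1 lerDl vnorm_ge0.
have bound n x : ((`[g x - h n x] `^ p)%:E <= ((2 / 2 ^+ n) `^ p)%:E * F x)%E.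
  have c0 : 0 < 2 / 2 ^+ n :> R by rewrite divr_gt0// exprn_gt0.
  case: (boolP (D x)) => Dx; last first.
    have -> : F x = +oo%E by apply/eqP; move: Dx; rewrite /D -leNgt leye_eq.
    by rewrite gt0_muley ?leey// lte_fin powR_gt0.
  have Ff : F x \is a fin_num by rewrite ge0_fin_numE.
  rewrite -(fineK Ff) -EFinM lee_fin.
  have -> : fine (F x) = K x `^ p.
    by rewrite /K -powRrM mulVf ?gt_eqF// powRr1// fine_ge0.
  rewrite -powRM ?(ltW c0)//; apply: powR_le; rewrite ?(ltW p0) ?vnorm_ge0//.
  rewrite mulrAC; apply: (@geometric_steps_limit_dist (fun n => h n x)) => // [m|].
    exact: step.
  have := gP x; rewrite /P/=.
  by under eq_fun do rewrite hDin//.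
have mgh n : vmeasurable (fun x => g x - h n x).
  have [mh _] := (LsP ip mu (h n) p0).1 (Lh n); exact: (vmeasurableB ip mg mh).
have igh n : (\int[mu]_x (`[g x - h n x] `^ p)%:E <= ((2 / 2 ^+ n) `^ p)%:E)%E.
  have mm := measurable_vnorm_powR ip p (mgh n).
  apply: (@le_trans _ _ (\int[mu]_x (((2 / 2 ^+ n) `^ p)%:E * F x))%E).
    apply: ge0_le_integral => //.
    - by move=> x _; rewrite lee_fin powR_ge0.
    - exact/measurable_EFinP.
    - exact: measurable_funeM.
  rewrite ge0_integralZl_EFin ?powR_ge0//.
  by rewrite -[leRHS]mule1; apply: lee_pmul => //; rewrite ?lee_fin ?powR_ge0// integral_ge0.
have Lgh n : Ls ip mu p (fun x => g x - h n x).
  apply/LsP => //; split; first exact: mgh.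
  apply/integrable_ge0P.
  - exact: measurable_vnorm_powR.
  - by move=> x; exact: powR_ge0.
  by apply: le_lt_trans (igh n) _; rewrite ltry.
exists g => [|n].
  have := LsD p0 (Lgh 0%N) (Lh 0%N).
  by under eq_fun do rewrite subrK.
by rewrite -lee_fin -integral_EFinE ?igh//; have /LsP[] := Lgh n.
Qed.

End Completeness.

(** * Best approximation in [L^p] *)

Section BestApproximation.
Context {R : realType} {k : scalar_kind} {V : vectType (scalars R k)}.
Variable ip : {dot V for @sconj R k}.
Context {d : measure_display} {X : measurableType d}.
Variable mu : {measure set X -> \bar R}.
Implicit Types (f g h u v : X -> V).

Local Notation "`[ u ]" := (vnorm ip u) (format "`[ u ]").
Local Notation Ls := (Ls ip mu).

(** The [p]-th power of the norm of [L^p]. *)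
Definition npow p f : R := \int[mu]_x (`[f x] `^ p).

Definition vmid f g : X -> V := fun x => sreal 2^-1 *: (f x + g x).

Lemma npow_ge0 p f : 0 <= npow p f.
Proof. by apply: Rintegral_ge0 => x _; exact: powR_ge0. Qed.

Lemma Ls_integrable p f : 0 < p -> Ls p f ->
  mu.-integrable setT (EFin \o (fun x => `[f x] `^ p)).
Proof. by move=> p0 /(LsP ip mu f p0)[]. Qed.

Lemma npow_EFin p f : 0 < p -> Ls p f ->
  (\int[mu]_x (`[f x] `^ p)%:E)%E = (npow p f)%:E.
Proof. by move=> p0 Lf; rewrite (integral_EFinE (Ls_integrable p0 Lf)). Qed.

Lemma npowB_le p f g h : 0 < p -> Ls p f -> Ls p g -> Ls p h ->
  npow p (f \- h) <= 2 `^ p * (npow p (f \- g) + npow p (g \- h)).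
Proof.
move=> p0 Lf Lg Lh; rewrite /npow.
have i1 := Ls_integrable p0 (LsB p0 Lf Lg).
have i2 := Ls_integrable p0 (LsB p0 Lg Lh).
have i12 := integrable_EFinD i1 i2.
rewrite -(RintegralD measurableT i1 i2) -(RintegralZl _ measurableT i12).
apply: Rintegral_le.
- exact: (Ls_integrable p0 (LsB p0 Lf Lh)).
- exact: (integrable_EFinZ _ i12).
move=> x; apply: le_trans (powRD_le2 (ltW p0) (vnorm_ge0 _ _) (vnorm_ge0 _ _)).
apply: powR_le; rewrite ?(ltW p0) ?vnorm_ge0//=.
have -> : f x - h x = (f x - g x) + (g x - h x) by rewrite addrA subrK.
exact: ler_vnormD.
Qed.

Section Exponent.
Variable p : R.
Hypothesis p1 : 1 < p.

Let p0 : 0 < p. Proof. exact: lt_trans p1. Qed.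

Lemma Ls_vmid f g : Ls p f -> Ls p g -> Ls p (vmid f g).
Proof. by move=> Lf Lg; exact: LsZ (LsD _ _ _). Qed.

Lemma vnorm_mid_powR (u v : V) :
  `[sreal 2^-1 *: (u + v)] `^ p <= (`[u] `^ p + `[v] `^ p) / 2.
Proof.
apply: le_trans (midpoint_powR p1 (vnorm_ge0 _ _) (vnorm_ge0 _ _)).
apply: powR_le; rewrite ?(ltW p0) ?vnorm_ge0// vnormZ ger0_norm; last by lra.
by rewrite mulrC ler_wpM2r ?ler_vnormD//; lra.
Qed.

(** Vectors that are close compared to their size are covered by the first term
    on the right, all others by uniform convexity. *)
Lemma vnormB_powR_le_gap e : 0 < e -> exists2 C, 0 <= C & forall u v : V,
  `[u - v] `^ p <= e * (`[u] `^ p + `[v] `^ p) +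
    C * (2^-1 * (`[u] `^ p + `[v] `^ p) + (- 1) * `[sreal 2^-1 *: (u + v)] `^ p).
Proof.
move=> e0; pose a := (e / 2 `^ p) `^ p^-1.
have a0 : 0 < a by rewrite powR_gt0// divr_gt0// powR_gt0.
have ap : a `^ p * 2 `^ p = e.
  rewrite /a -powRrM mulVf ?gt_eqF// powRr1 ?divfK ?gt_eqF ?powR_gt0//.
  by rewrite divr_ge0 ?powR_ge0// ltW.
have [c c0 Hc] := vnorm_uniform_convexity ip p1 a0.
exists c^-1 => [|u v]; first by rewrite invr_ge0 ltW.
have gap := vnorm_mid_powR u v; have {Hc} far := Hc u v.
have uv := ler_vnormB ip u v.
have := vnorm_ge0 ip (u - v); have := vnorm_ge0 ip u; have := vnorm_ge0 ip v.
move: gap far uv; move: `[u] `[v] `[u - v] `[_ *: _] => s t w m.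
move=> gap far uv t0 s0 w0; clearbody a.
have S0 : 0 <= s `^ p + t `^ p by rewrite addr_ge0 ?powR_ge0.
move: gap far S0; have := powRD_le2 (ltW p0) s0 t0.
move: (m `^ p) (s `^ p + t `^ p) => M A le2 gap far A0.
have {}gap : 0 <= 2^-1 * A + -1 * M by lra.
have [/far {}far|close] := leP (a * (s + t)) w.
  have h1 : w `^ p <= (s + t) `^ p by apply: powR_le => //; exact: ltW.
  have h2 : (s + t) `^ p <= c^-1 * (2^-1 * A + -1 * M).
    by rewrite mulrC ler_pdivlMr// mulrC; lra.
  apply: (le_trans h1); apply: (le_trans h2).
  by rewrite lerDr mulr_ge0// ltW.
have h1 : w `^ p <= e * A.
  apply: (@le_trans _ _ ((a * (s + t)) `^ p)).
    by apply: powR_le; rewrite ?(ltW p0)// ltW.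
  rewrite powRM ?addr_ge0 ?(ltW a0)// -ap -mulrA.
  by apply: ler_wpM2l; first exact: powR_ge0.
by apply: le_trans h1 _; rewrite lerDl mulr_ge0// invr_ge0 ltW.
Qed.

(** Uniform convexity in integrated form.  When [u] and [v] almost minimize the
    norm on a set that contains their midpoint, the bracket is small. *)
Lemma npowB_le_midpoint_gap e : 0 < e -> exists2 C, 0 <= C &
  forall u v, Ls p u -> Ls p v -> npow p (u \- v) <=
    e * (npow p u + npow p v) + C * ((npow p u + npow p v) / 2 - npow p (vmid u v)).
Proof.
move=> /vnormB_powR_le_gap[C C0 HC]; exists C => // u v Lu Lv.
have iu := Ls_integrable p0 Lu; have iv := Ls_integrable p0 Lv.
have im := Ls_integrable p0 (Ls_vmid Lu Lv).
have iuv := integrable_EFinD iu iv.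
have iuv2 := integrable_EFinZ 2^-1 iuv.
have imN := integrable_EFinZ (- 1) im.
have ih := integrable_EFinD iuv2 imN.
have -> : e * (npow p u + npow p v) +
    C * ((npow p u + npow p v) / 2 - npow p (vmid u v)) =
  \int[mu]_x (e * (`[u x] `^ p + `[v x] `^ p) +
    C * (2^-1 * (`[u x] `^ p + `[v x] `^ p) + (- 1) * `[vmid u v x] `^ p)).
  rewrite (RintegralD measurableT (integrable_EFinZ e iuv) (integrable_EFinZ C ih)).
  rewrite (RintegralZl _ measurableT iuv) (RintegralZl _ measurableT ih).
  rewrite (RintegralD measurableT iuv2 imN) (RintegralZl _ measurableT iuv).
  rewrite (RintegralZl _ measurableT im) (RintegralD measurableT iu iv).
  by congr (_ + _ * _); rewrite mulN1r mulrC.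
apply: Rintegral_le => [||x].
- exact: (Ls_integrable p0 (LsB p0 Lu Lv)).
- exact: (integrable_EFinD (integrable_EFinZ e iuv) (integrable_EFinZ C ih)).
- exact: HC.
Qed.

Section Projection.
Variable S : set (X -> V).
Hypotheses (SLs : S `<=` Ls p) (S0 : S (fun=> 0))
  (Smid : forall g h, S g -> S h -> S (vmid g h))
  (Sclosed : forall g, Ls p g ->
    (forall e, 0 < e -> exists2 h, S h & npow p (g \- h) < e) -> S g).

(** A minimizing sequence is Cauchy because the midpoint of two almost
    minimizers again belongs to [S]. *)
Lemma best_approximation_exists f : Ls p f ->
  exists2 g, S g & forall h, S h -> npow p (f \- g) <= npow p (f \- h).
Proof.
move=> Lf.
have [m [m0 mle almost]] : exists m, [/\ 0 <= m,
    forall h, S h -> m <= npow p (f \- h) &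
    forall e, 0 < e -> exists2 h, S h & npow p (f \- h) < m + e].
  pose D := [set npow p (f \- h) | h in S].
  have Dinf : has_inf D.
    split; first by exists (npow p (f \- fun=> 0)), (fun=> 0).
    by exists 0 => _ [h _ <-]; exact: npow_ge0.
  exists (inf D); split.
  - by apply: lb_le_inf; [case: Dinf|move=> _ [h _ <-]; exact: npow_ge0].
  - by move=> h Sh; apply: ge_inf; [case: Dinf|exists h].
  - by move=> e /inf_adherent/(_ Dinf)[_ [h Sh <-] he]; exists h.
have close eta : 0 < eta -> exists2 e, 0 < e & forall g h, S g -> S h ->
    npow p (f \- g) < m + e -> npow p (f \- h) < m + e ->
    npow p (h \- g) <= eta.
  move=> eta0; have a0 : 0 < eta / (4 * (m + 1)) by rewrite divr_gt0//; lra.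
  have [C C0 HC] := npowB_le_midpoint_gap a0.
  have [e [e0 e1 e2]] : exists e, [/\ 0 < e, e <= 1 & C * e <= eta / 2].
    have C1 : 0 < C + 1 by lra.
    have b0 : 0 < eta / (2 * (C + 1)) by rewrite divr_gt0// mulr_gt0.
    exists (Num.min 1 (eta / (2 * (C + 1)))).
    rewrite lt_min ltr01 b0 ge_min lexx; split=> //.
    apply: (@le_trans _ _ ((C + 1) * (eta / (2 * (C + 1))))).
      by apply: ler_pM; rewrite ?lerDl ?le_min ?ler01 ?(ltW b0) ?ge_min ?lexx ?orbT.
    by rewrite le_eqVlt; apply/orP; left; apply/eqP; field; rewrite gt_eqF.
  exists e => // g h Sg Sh hg hh.
  have := HC _ _ (LsB p0 Lf (SLs Sg)) (LsB p0 Lf (SLs Sh)).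
  have -> : npow p ((fun x => f x - g x) \- (fun x => f x - h x)) =
            npow p (h \- g).
    by apply: eq_Rintegral => x _ /=; rewrite opprB addrC addrA subrK.
  have -> : npow p (vmid (fun x => f x - g x) (fun x => f x - h x)) =
            npow p (f \- vmid g h).
    apply: eq_Rintegral => x _ /=; rewrite /vmid; congr (`[_] `^ p).
    by rewrite addrACA -opprD scalerBr sreal_half.
  move=> /le_trans; apply.
  have := mle _ (Smid Sg Sh).
  move: hg hh; move: (npow p (f \- g)) (npow p (f \- h)) (npow p (f \- vmid g h)).
  move=> A B M hg hh mM; clear - hg hh mM m0 e0 e1 e2 C0 eta0 a0.
  have t1 : eta / (4 * (m + 1)) * (A + B) <= eta / 2.
    have -> : eta / 2 = eta / (4 * (m + 1)) * (2 * (m + 1)) by field; lra.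
    by apply: ler_wpM2l; [exact: ltW|lra].
  have t2 : C * ((A + B) / 2 - M) <= eta / 2.
    by apply: le_trans e2; apply: ler_wpM2l => //; lra.
  by move: t1 t2; lra.
pose eta n : R := 1 / (2 ^ n.+1)%:R / (2 ^+ n) `^ p.
have eta0 n : 0 < eta n.
  by rewrite !divr_gt0// ?ltr0n ?expn_gt0// powR_gt0// exprn_gt0.
have /choice[eps Heps] n : exists e, 0 < e /\ forall g h, S g -> S h ->
    npow p (f \- g) < m + e -> npow p (f \- h) < m + e ->
    npow p (h \- g) <= eta n.
  by have [e e0 He] := close _ (eta0 n); exists e.
(* [h n] is compared with [h n.+1] and with [h n.-1], hence two bounds; the
   first one makes the sequence minimizing. *)
pose tol n := Num.min (1 / 2 ^+ n) (Num.min (eps n) (eps n.-1)).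
have tol0 n : 0 < tol n.
  by rewrite !lt_min (Heps n).1 (Heps n.-1).1 !andbT divr_gt0// exprn_gt0.
have /choice[h Hh] n : exists h, S h /\ npow p (f \- h) < m + tol n.
  by have [h Sh hh] := almost _ (tol0 n); exists h.
have Sh n := (Hh n).1.
have [|n|g Lg gh] := @Lp_complete _ _ _ ip _ _ mu p h p0.
- by move=> n; exact: SLs.
- apply: (Heps n).2 => //; apply: lt_le_trans (Hh _).2 _; rewrite lerD2l.
    by rewrite /tol !ge_min lexx orbT.
  by rewrite /tol !ge_min lexx !orbT.
have gh' n : npow p (g \- h n) <= 2 `^ p / 2 ^+ n.
  apply: le_trans (gh n) _; rewrite powRM// ?invr_ge0 ?exprn_ge0//.
  rewrite ler_wpM2l ?powR_ge0// -[leRHS]powRr1 ?invr_ge0 ?exprn_ge0//.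
  apply: ger_powR; last exact: ltW.
  by rewrite invr_gt0 exprn_gt0//= invf_le1 ?exprn_gt0// exprn_ege1// ler1n.
have Sg : S g.
  apply: Sclosed => // e e0; have [n Hn] := exists_div_expn2_lt (2 `^ p) e0.
  by exists (h n) => //; apply: le_lt_trans Hn.
have fh n : npow p (f \- h n) <= m + 1 / 2 ^+ n.
  by apply: le_trans (ltW (Hh n).2) _; rewrite lerD2l /tol ge_min lexx.
exists g; first exact: Sg.
move=> h' Sh'; apply: le_trans (mle _ Sh').
move: gh' Sh fh; clear - p1 p0 SLs Lf Lg m0 => gh' Sh fh.
apply/ler_addgt0Pr => e e0.
have a0 : 0 < e / (2 * (m + 1)) by rewrite divr_gt0//; lra.
have [C C0 HC] := powRD_le_eta p0 a0; set a := e / _ in a0 HC.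
have ae : a * (m + 1) = e / 2 by rewrite /a; field; lra.
clearbody a.
have e20 : 0 < e / 2 by lra.
have [n Hn] := exists_div_expn2_lt (1 + a + C * 2 `^ p) e20.
have ifh := Ls_integrable p0 (LsB p0 Lf (SLs (Sh n))).
have ihg := Ls_integrable p0 (LsB p0 Lg (SLs (Sh n))).
have h1 : npow p (f \- g) <= (1 + a) * npow p (f \- h n) + C * npow p (g \- h n).
  have -> : (1 + a) * npow p (f \- h n) + C * npow p (g \- h n) = \int[mu]_x
      ((1 + a) * `[f x - h n x] `^ p + C * `[g x - h n x] `^ p).
    rewrite (RintegralD measurableT (integrable_EFinZ _ ifh) (integrable_EFinZ _ ihg)).
    by rewrite (RintegralZl _ measurableT ifh) (RintegralZl _ measurableT ihg).
  apply: Rintegral_le; first exact: (Ls_integrable p0 (LsB p0 Lf Lg)).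
    exact: (integrable_EFinD (integrable_EFinZ _ ifh) (integrable_EFinZ _ ihg)).
  move=> x; apply: le_trans (HC _ _ (vnorm_ge0 _ _) (vnorm_ge0 _ _)).
  apply: powR_le; rewrite ?(ltW p0) ?vnorm_ge0//= (vdistC _ (g x)).
  have -> : f x - g x = (f x - h n x) + (h n x - g x) by rewrite addrA subrK.
  exact: ler_vnormD.
have {}gh' := gh' n; have {}fh := fh n.
move: h1 gh' fh Hn.
move: (npow p (f \- g)) (npow p (f \- h n)) (npow p (g \- h n)) => A B D.
clear - a0 ae C0 m0; move=> h1 gh' fh Hn.
have h2 : C * D <= C * (2 `^ p / 2 ^+ n) by exact: ler_wpM2l.
have h3 : (1 + a) * B <= (1 + a) * (m + 1 / 2 ^+ n) by apply: ler_wpM2l => //; lra.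
have h4 : (1 + a + C * 2 `^ p) / 2 ^+ n =
    (1 + a) * (1 / 2 ^+ n) + C * (2 `^ p / 2 ^+ n).
  by field; rewrite gt_eqF// exprn_gt0.
move: h2 h3 h4 Hn => h2 h3 h4; rewrite h4; move: h2 h3 {h4}.
move: (2 `^ p / 2 ^+ n) (1 / 2 ^+ n) => x y h2 h3 Hn; lra.
Qed.

End Projection.
End Exponent.
End BestApproximation.

Section LpProjection.
Context {R : realType} {k : scalar_kind} {V : vectType (scalars R k)}.
Variable ip : {dot V for @sconj R k}.
Context {d : measure_display} {X : measurableType d}.
Variable mu : {measure set X -> \bar R}.
Variables (L2p : set (X -> V)) (hL2p : closed_subspace_L2 ip mu L2p).
Variables (p : R) (p1 : 1 < p).
Implicit Types (f g h : X -> V).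

Local Notation "`[ u ]" := (vnorm ip u) (format "`[ u ]").
Local Notation Ls := (Ls ip mu).
Local Notation Lsp := (Lsp ip mu L2p).
Local Notation npow := (npow ip mu).

Let p0 : 0 < p. Proof. exact: lt_trans p1. Qed.

Lemma Lsp_Ls g : Lsp p g -> Ls p g. Proof. by case. Qed.

Lemma LspP g : Lsp p g <-> Ls p g /\ forall e, 0 < e ->
  exists h, [/\ L2p h, Ls p h & npow p (g \- h) < e].
Proof.
split=> -[Lg H]; split=> // e e0.
  have e1 : 0 < e `^ p^-1 by exact: powR_gt0.
  have [h [L2h Lh]] := H _ e1.
  move=> /(Ldist_ltP p0 e1 (LsB p0 Lg Lh)) hh; exists h; split=> //.
  by move: hh; rewrite -powRrM mulVf ?gt_eqF// powRr1// ltW.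
have [h [L2h Lh hh]] := H _ (powR_gt0 p e0).
by exists h => //; apply/(Ldist_ltP p0 e0 (LsB p0 Lg Lh)).
Qed.

Lemma Lsp0 : Lsp p (fun=> 0).
Proof.
have [_ L20 _ _] := hL2p.
have n0 : (fun x : X => `[(fun=> 0 : V) x] `^ p) = fun=> 0.
  by apply/funext => x; rewrite vnorm0 powR0// gt_eqF.
have L0 : Ls p (fun=> 0).
  apply/LsP => //; split; last by rewrite n0; exact: integrable0.
  apply/(vmeasurableP ip) => w; under eq_fun do rewrite rip0l.
  exact: measurable_cst.
apply/LspP; split=> // e e0; exists (fun=> 0); split=> //.
have -> : npow p ((fun=> 0) \- (fun=> 0)) = \int[mu]_x 0.
  by apply: eq_Rintegral => x _; rewrite /= subr0 vnorm0 powR0// gt_eqF.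
by rewrite Rintegral_cst// mul0r.
Qed.

Lemma Lsp_vmid g h : Lsp p g -> Lsp p h -> Lsp p (vmid g h).
Proof.
have [_ L20 L2lin _] := hL2p.
move=> /LspP[Lg Hg] /LspP[Lh Hh]; apply/LspP; split; first exact: Ls_vmid.
move=> e e0; have [g' [L2g Lg' eg]] := Hg _ e0; have [h' [L2h Lh' eh]] := Hh _ e0.
exists (vmid g' h'); split; [|exact: Ls_vmid|].
  have := L2lin (sreal 2^-1) _ _ L2g (L2lin (sreal 2^-1) _ _ L2h L20).
  rewrite (_ : (fun x => _) = vmid g' h')//.
  by apply/funext => x; rewrite /vmid addr0 scalerDr.
have ig := Ls_integrable p0 (LsB p0 Lg Lg').
have ih := Ls_integrable p0 (LsB p0 Lh Lh').
have igh := integrable_EFinD ig ih.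
apply: (@le_lt_trans _ _ (2^-1 * (npow p (g \- g') + npow p (h \- h')))).
  rewrite -(RintegralD measurableT ig ih) -(RintegralZl _ measurableT igh).
  apply: Rintegral_le.
  - by apply: Ls_integrable => //; apply: LsB => //; exact: Ls_vmid.
  - exact: integrable_EFinZ.
  move=> x; rewrite mulrC.
  have -> : (vmid g h \- vmid g' h') x =
      sreal 2^-1 *: ((g x - g' x) + (h x - h' x)).
    by rewrite /= /vmid -scalerBr opprD addrACA.
  exact: vnorm_mid_powR.
by move: eg eh; move: (npow _ _) (npow _ _) => A B; lra.
Qed.

Lemma Lsp_closed g : Ls p g ->
  (forall e, 0 < e -> exists2 h, Lsp p h & npow p (g \- h) < e) -> Lsp p g.
Proof.
move=> Lg H; apply/LspP; split=> // e e0.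
have c0 : 0 < 2 `^ p :> R by exact: powR_gt0.
have e1 : 0 < e / (2 * 2 `^ p) by rewrite divr_gt0// mulr_gt0.
have [h /LspP[Lh Hh] gh] := H _ e1; have [h' [L2h Lh' hh]] := Hh _ e1.
exists h'; split=> //; apply: le_lt_trans (npowB_le p0 Lg Lh Lh') _.
have -> : e = 2 `^ p * (e / (2 * 2 `^ p) + e / (2 * 2 `^ p)).
  by field; rewrite gt_eqF.
by rewrite (ltr_pM2l c0); exact: (ltrD gh hh).
Qed.

Lemma is_Lp_projP f a : Ls p f -> is_Lp_proj ip mu L2p p f a <->
  Lsp p a /\ forall h, Lsp p h -> npow p (f \- a) <= npow p (f \- h).
Proof.
move=> Lf.
have E h : Lsp p h -> (\int[mu]_x (`[f x - h x] `^ p)%:E)%E = (npow p (f \- h))%:E.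
  move=> /Lsp_Ls Lh; have L : Ls p (f \- h) by exact: (LsB p0 Lf Lh).
  exact: (npow_EFin p0 L).
split=> -[Sa H]; (split; first exact: Sa) => h Sh; move: (H h Sh).
  by rewrite (E _ Sa) (E _ Sh) lee_fin.
by rewrite (E _ Sa) (E _ Sh) lee_fin.
Qed.

Lemma Lp_proj_exists f : Ls p f -> exists a, is_Lp_proj ip mu L2p p f a.
Proof.
move=> Lf.
have [a Sa Ha] := best_approximation_exists p1 Lsp_Ls Lsp0 Lsp_vmid Lsp_closed Lf.
by exists a; apply/is_Lp_projP.
Qed.

End LpProjection.

(** * Stability of the projection *)

Section MidpointGap.
Context {R : realType} {k : scalar_kind} {V : vectType (scalars R k)}.
Variable ip : {dot V for @sconj R k}.
Variables (p : R) (p1 : 1 < p).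
Implicit Types (u v : V).

Local Notation "`[ u ]" := (vnorm ip u) (format "`[ u ]").

Let p0 : 0 < p. Proof. exact: lt_trans p1. Qed.

(** How far the midpoint falls below the average of the [p]-th powers. *)
Definition midgap u v : R :=
  2^-1 * (`[u] `^ p + `[v] `^ p) + (- 1) * `[sreal 2^-1 *: (u + v)] `^ p.

Lemma midgap_ge0 u v : 0 <= midgap u v.
Proof.
rewrite /midgap; have := vnorm_mid_powR ip p1 u v.
by move: (_ `^ p) (_ `^ p) (_ `^ p) => A B C; lra.
Qed.

Lemma midgapC u v : midgap u v = midgap v u.
Proof. by rewrite /midgap (addrC u) (addrC (`[u] `^ p)). Qed.

Lemma midgap_far : exists2 c, 0 < c & forall u v,
  3 * `[v] <= `[u] -> c * (`[u] + `[v]) `^ p <= midgap u v.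
Proof.
have half0 : 0 < 2^-1 :> R by lra.
have [c c0 H] := vnorm_uniform_convexity ip p1 half0.
exists c => // u v uv; rewrite /midgap.
have : 2^-1 * (`[u] + `[v]) <= `[u - v].
  have := ler_vnormD ip (u - v) v; rewrite subrK.
  by move: uv; move: `[u] `[v] `[u - v] => a b w; lra.
by move/H; move: (_ `^ p) (_ `^ p) (_ `^ p) (_ `^ p) => A B C D; lra.
Qed.

(** Either [|v|] is at most [3 |u|], and the midpoint is bounded by [2 |u|], or
    [u] and [v] are far apart and the gap bounds everything. *)
Lemma vnorm_mid_powR_le_midgap : exists2 c, 0 < c & forall u v,
  `[sreal 2^-1 *: (u + v)] `^ p <= 2 `^ p * `[u] `^ p + c * midgap u v.
Proof.
have [c c0 H] := midgap_far; exists c^-1 => [|u v]; first by rewrite invr_gt0.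
have m_le : `[sreal 2^-1 *: (u + v)] <= (`[u] + `[v]) / 2.
  rewrite vnormZ ger0_norm; last by lra.
  by rewrite mulrC ler_wpM2r ?ler_vnormD//; lra.
have u0 := vnorm_ge0 ip u; have v0 := vnorm_ge0 ip v.
have m0 := vnorm_ge0 ip (sreal 2^-1 *: (u + v)).
have [uv|vu] := leP (3 * `[u]) `[v].
  apply: (@le_trans _ _ (c^-1 * midgap u v)); last first.
    by rewrite lerDr mulr_ge0 ?powR_ge0.
  rewrite mulrC ler_pdivlMr// mulrC midgapC; apply: le_trans (H _ _ uv).
  apply: ler_wpM2l; first exact: ltW.
  by apply: powR_le; rewrite ?(ltW p0)//; lra.
apply: (@le_trans _ _ (2 `^ p * `[u] `^ p)); last first.
  by rewrite lerDl mulr_ge0 ?midgap_ge0// invr_ge0 ltW.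
by rewrite -powRM//; apply: powR_le; rewrite ?(ltW p0)//; lra.
Qed.

(** If [|a|] is large while [|f|] and [|a'|] are small, then [f - a] is much
    larger than [f' - a'], and the gap is comparable to its [p]-th power. *)
Lemma level_le_midgap : exists2 c, 0 < c & forall f f' a a' t, 0 < t ->
  `[f'] <= `[f] -> ((7 * t < `[a])%R%:R : R) <=
    (t < `[a'])%R%:R + (t < `[f])%R%:R
    + t `^ (- p) * (c * midgap (f - a) (f' - a')).
Proof.
have [c c0 H] := midgap_far; exists c^-1 => [|f f' a a' t t0 ff].
  by rewrite invr_gt0.
have g0 : 0 <= t `^ (- p) * (c^-1 * midgap (f - a) (f' - a')).
  by rewrite mulr_ge0 ?powR_ge0// mulr_ge0 ?midgap_ge0// invr_ge0 ltW.
have le1 (b : bool) : (b%:R : R) <= true%:R by case: b.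
have [ta|ta] := ltP t `[a'].
  by apply: le_trans (le1 _) _; rewrite -addrA lerDl addr_ge0 ?ler0n.
have [tf|tf] := ltP t `[f].
  by apply: le_trans (le1 _) _; rewrite -addrA addrCA lerDl addr_ge0 ?ler0n.
(* Now [|f' - a'| <= 2 t] and [|f - a| >= 6 t], and the ratio [3] is the one of
   [midgap_far]. *)
rewrite !add0r; have [ta7|//] := ltP (7 * t) `[a].
have b'2 : `[f' - a'] <= 2 * t by have := ler_vnormB ip f' a'; lra.
have b6 : 6 * t <= `[f - a].
  by have := ler_vnormB ip f (f - a); rewrite opprB addrCA subrr addr0; lra.
have far : 3 * `[f' - a'] <= `[f - a] by lra.
have := H _ _ far; set g := midgap _ _ => Hg.
rewrite powRN mulrC ler_pdivlMr ?powR_gt0// mul1r mulrC ler_pdivlMr//.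
apply: le_trans Hg; rewrite mulrC; apply: ler_wpM2l; first exact: ltW.
by apply: powR_le; have := vnorm_ge0 ip (f' - a'); rewrite ?(ltW p0) ?(ltW t0)//; lra.
Qed.

End MidpointGap.

Section Stability.
Context {R : realType} {k : scalar_kind} {V : vectType (scalars R k)}.
Variable ip : {dot V for @sconj R k}.
Context {d : measure_display} {X : measurableType d}.
Variable mu : {measure set X -> \bar R}.
Variables (L2p : set (X -> V)) (hL2p : closed_subspace_L2 ip mu L2p).
Variables (p : R) (p1 : 1 < p).
Implicit Types (f g h a : X -> V) (A : X -> bool).

Local Notation "`[ u ]" := (vnorm ip u) (format "`[ u ]").
Local Notation Ls := (Ls ip mu).
Local Notation Lsp := (Lsp ip mu L2p).
Local Notation npow := (npow ip mu).
Local Notation is_proj := (is_Lp_proj ip mu L2p p).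
Local Notation midgap := (midgap ip p).
Local Notation integrable h := (mu.-integrable setT (EFin \o h)).

Let p0 : 0 < p. Proof. exact: lt_trans p1. Qed.

Lemma integrable_midgap f g : Ls p f -> Ls p g ->
  integrable (fun x => midgap (f x) (g x)).
Proof.
move=> Lf Lg; apply: integrable_EFinD; apply: integrable_EFinZ.
  by apply: integrable_EFinD; exact: Ls_integrable.
exact: (Ls_integrable p0 (Ls_vmid p1 Lf Lg)).
Qed.

Lemma Rintegral_midgap f g : Ls p f -> Ls p g ->
  \int[mu]_x midgap (f x) (g x) =
  2^-1 * (npow p f + npow p g) + (- 1) * npow p (vmid f g).
Proof.
move=> Lf Lg; have fi := Ls_integrable p0 Lf; have gi := Ls_integrable p0 Lg.
have mi := Ls_integrable p0 (Ls_vmid p1 Lf Lg).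
have fgi := integrable_EFinD fi gi.
rewrite /midgap (RintegralD measurableT (integrable_EFinZ 2^-1 fgi)
  (integrable_EFinZ (- 1) mi)).
rewrite (RintegralZl _ measurableT fgi) (RintegralZl _ measurableT mi).
by rewrite (RintegralD measurableT fi gi).
Qed.

(** Stability of the nonlinear projection under cutting [f] to zero on [A].
    The midpoint of the two projections competes with both of them; away from
    [A] the two resulting inequalities cancel, and what remains is an integral
    over [A]. *)
Lemma proj_cut_stability eta : 0 < eta -> exists2 C, 0 <= C &
  forall f A a a', Ls p f -> measurable_fun setT A ->
    is_proj f a -> is_proj (cut A f) a' ->
    \int[mu]_x midgap (f x - a x) (cut A f x - a' x) <=
      \int[mu]_x ((A x)%:R * (eta * `[f x - a x] `^ p + C * `[f x] `^ p)).
Proof.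
move=> eta0; have half1 : `|2^-1 : R| <= 1 by rewrite ger0_norm; lra.
have [c c0 Hc] := vnorm_mid_powR_le_midgap ip p1.
have twop : 0 < 2 `^ p :> R by exact: powR_gt0.
(* The first bound lets half of the integral of the gap be absorbed into the
   left side; the second one turns [e] into [eta]. *)
pose e := Num.min (2^-1 / c) (eta / (2 * 2 `^ p)).
have e0 : 0 < e by rewrite lt_min !divr_gt0// ?mulr_gt0// invr_gt0.
have ec : e * c <= 2^-1 by rewrite -ler_pdivlMr// /e ge_min lexx.
have ep : e * (2 * 2 `^ p) <= eta.
  by rewrite -ler_pdivlMr ?mulr_gt0// /e ge_min lexx orbT.
clearbody e; have [C C0 HC] := powRD_le_eta p0 e0.
exists (2 * C) => [|f A a a' Lf mA]; first by rewrite mulr_ge0.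
have Lcf : Ls p (cut A f) by exact: Ls_cut.
move=> /(is_Lp_projP L2p p1 a Lf)[Sa Ha] /(is_Lp_projP L2p p1 a' Lcf)[Sa' Ha'].
have La := Lsp_Ls Sa; have La' := Lsp_Ls Sa'.
set b := (fun x => f x - a x); set b' := (fun x => cut A f x - a' x).
have Lb : Ls p b by exact: LsB.
have Lb' : Ls p b' by exact: LsB.
have Lm : Ls p (vmid b b') by exact: Ls_vmid.
have im := Ls_integrable p0 Lm.
have ib := Ls_integrable p0 Lb; have ib' := Ls_integrable p0 Lb'.
have fi := Ls_integrable p0 Lf.
have ig : integrable (fun x => midgap (b x) (b' x)) by exact: integrable_midgap.
have iAm : integrable (fun x =>
    (A x)%:R * (e * `[vmid b b' x] `^ p + C * `[f x] `^ p)).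
  apply: (integrable_mul_indb mA).
    by move=> x; rewrite addr_ge0// mulr_ge0 ?powR_ge0// ltW.
  exact: (integrable_EFinD (integrable_EFinZ e im) (integrable_EFinZ C fi)).
have iAb : integrable (fun x =>
    (A x)%:R * (eta * `[b x] `^ p + 2 * C * `[f x] `^ p)).
  apply: (integrable_mul_indb mA).
    by move=> x; rewrite addr_ge0 ?mulr_ge0 ?powR_ge0// ltW.
  exact: (integrable_EFinD (integrable_EFinZ eta ib) (integrable_EFinZ (2 * C) fi)).
have pert (u v : V) : `[u + v] `^ p <= (1 + e) * `[u] `^ p + C * `[v] `^ p.
  apply: le_trans (HC _ _ (vnorm_ge0 _ _) (vnorm_ge0 _ _)).
  by apply: powR_le; rewrite ?(ltW p0) ?vnorm_ge0 ?ler_vnormD.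
have halfp (v : V) : `[sreal 2^-1 *: v] `^ p <= `[v] `^ p.
  apply: powR_le; rewrite ?(ltW p0) ?vnorm_ge0// vnormZ.
  by rewrite ler_piMl ?vnorm_ge0.
have comp x :
    `[f x - vmid a a' x] `^ p <= `[vmid b b' x] `^ p +
      (A x)%:R * (e * `[vmid b b' x] `^ p + C * `[f x] `^ p) /\
    `[cut A f x - vmid a a' x] `^ p <= `[vmid b b' x] `^ p +
      (A x)%:R * (e * `[vmid b b' x] `^ p + C * `[f x] `^ p).
  have fx : f x = sreal 2^-1 *: f x + sreal 2^-1 *: f x.
    by rewrite -scalerDr sreal_half.
  rewrite /vmid /b /b' /cut; case: (A x); last first.
    rewrite mul0r addr0; split; rewrite {1}fx -!scalerDr -scalerBr.
      by rewrite [X in _ <= `[_ *: X] `^ p]addrACA -opprD.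
    by rewrite [X in _ <= `[_ *: X] `^ p]addrACA -opprD.
  rewrite mul1r addrA -[X in X + e * _]mul1r -mulrDl.
  split.
    have -> : f x - sreal 2^-1 *: (a x + a' x) =
        sreal 2^-1 *: (f x - a x + (0 - a' x)) + sreal 2^-1 *: f x.
      rewrite {1}fx -!scalerDr -scalerBr; congr (_ *: _).
      by rewrite sub0r opprD -!addrA; congr (_ + _); rewrite addrC -addrA.
    by apply: le_trans (pert _ _) _; rewrite lerD2l; exact: ler_wpM2l.
  have -> : 0 - sreal 2^-1 *: (a x + a' x) =
      sreal 2^-1 *: (f x - a x + (0 - a' x)) + - (sreal 2^-1 *: f x).
    rewrite -scalerBr !sub0r -scalerN opprD; congr (_ *: _).
    by rewrite addrAC [f x - a x - f x]addrAC subrr add0r.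
  apply: le_trans (pert _ _) _; rewrite lerD2l vnormN; exact: ler_wpM2l.
have iM := integrable_EFinD im iAm.
have lem : npow p b <= npow p (vmid b b') + \int[mu]_x ((A x)%:R *
    (e * `[vmid b b' x] `^ p + C * `[f x] `^ p)).
  apply: le_trans (Ha _ (Lsp_vmid hL2p p1 Sa Sa')) _.
  rewrite -(RintegralD measurableT im iAm); apply: Rintegral_le => [||x].
  - exact: (Ls_integrable p0 (LsB p0 Lf (Ls_vmid p1 La La'))).
  - exact: iM.
  - exact: (comp x).1.
have lem' : npow p b' <= npow p (vmid b b') + \int[mu]_x ((A x)%:R *
    (e * `[vmid b b' x] `^ p + C * `[f x] `^ p)).
  apply: le_trans (Ha' _ (Lsp_vmid hL2p p1 Sa Sa')) _.
  rewrite -(RintegralD measurableT im iAm); apply: Rintegral_le => [||x].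
  - exact: (Ls_integrable p0 (LsB p0 Lcf (Ls_vmid p1 La La'))).
  - exact: iM.
  - exact: (comp x).2.
have lemA : \int[mu]_x ((A x)%:R * (e * `[vmid b b' x] `^ p + C * `[f x] `^ p))
   <= 2^-1 * \int[mu]_x midgap (b x) (b' x) + 2^-1 * \int[mu]_x
     ((A x)%:R * (eta * `[b x] `^ p + 2 * C * `[f x] `^ p)).
  rewrite -(RintegralZl _ measurableT ig) -(RintegralZl _ measurableT iAb).
  have ig2 := integrable_EFinZ 2^-1 ig; have iAb2 := integrable_EFinZ 2^-1 iAb.
  rewrite -(RintegralD measurableT ig2 iAb2).
  apply: Rintegral_le => [||x]; [exact: iAm|exact: (integrable_EFinD ig2 iAb2)|].
  have g0 := midgap_ge0 ip p1 (b x) (b' x).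
  have hm := Hc (b x) (b' x); rewrite -/(vmid b b' x) in hm.
  case: (A x); last by rewrite !mul0r mulr0 addr0 mulr_ge0.
  have B0 : 0 <= `[b x] `^ p by exact: powR_ge0.
  move: g0 hm B0; move: (midgap (b x) (b' x)) (`[vmid b b' x] `^ p).
  move: (`[b x] `^ p) (`[f x] `^ p) (2 `^ p) ep => B F T ep G M G0 hm B0.
  have h1 : e * M <= e * (T * B + c * G) by apply: ler_wpM2l => //; exact: ltW.
  have h2 : e * c * G <= 2^-1 * G by exact: ler_wpM2r.
  have h3 : e * (2 * T) * B <= eta * B by exact: ler_wpM2r.
  by rewrite !mul1r; clear - h1 h2 h3; lra.
move: lem lem' lemA (Rintegral_midgap Lb Lb').
move: (\int[mu]_x midgap (b x) (b' x)) (npow p b) (npow p b') (npow p (vmid b b')).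
move=> G N N' M; move: (\int[mu]_x _) (\int[mu]_x _) => I J.
by move=> h1 h2 h3 h4; clear - h1 h2 h3 h4; lra.
Qed.

End Stability.

(** * Distribution functions *)

Section Levels.
Context {d : measure_display} {X : measurableType d} {R : realType}.
Variable mu : {measure set X -> \bar R}.
Implicit Types (h : X -> R) (p r t c : R).

Local Notation integrable h := (mu.-integrable setT (EFin \o h)).

(** The distribution function of [h]. *)
Definition level h t : R := \int[mu]_x (t < h x)%R%:R.

Lemma measurable_above h t : measurable_fun setT h ->
  measurable_fun setT (fun x => (t < h x)%R).
Proof. by move=> mh; exact: measurable_fun_ltr. Qed.

Lemma above_le_powR p t (s : R) : 0 < p -> 0 < t -> 0 <= s ->
  ((t < s)%R%:R : R) <= t `^ (- p) * s `^ p.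
Proof.
move=> p0 t0 s0; have [ts|_] := ltP t s; last first.
  by rewrite mulr_ge0 ?powR_ge0.
rewrite powRN mulrC ler_pdivlMr ?powR_gt0// mul1r.
by apply: powR_le; rewrite ?ltW.
Qed.

Lemma integrable_above p h t : 0 < p -> 0 < t -> measurable_fun setT h ->
  (forall x, 0 <= h x) -> integrable (fun x => h x `^ p) ->
  integrable (fun x => (t < h x)%R%:R).
Proof.
move=> p0 t0 mh h0 ih.
apply: integrable_dominated (integrable_EFinZ (t `^ (- p)) ih).
  by apply: measurable_indb; exact: measurable_above.
by move=> x; rewrite ler0n above_le_powR.
Qed.

Lemma level_markov p h t : 0 < p -> 0 < t -> measurable_fun setT h ->
  (forall x, 0 <= h x) -> integrable (fun x => h x `^ p) ->
  level h t <= t `^ (- p) * \int[mu]_x (h x `^ p).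
Proof.
move=> p0 t0 mh h0 ih; rewrite -(RintegralZl _ measurableT ih).
apply: Rintegral_le => [||x].
- exact: integrable_above p0 t0 mh h0 ih.
- exact: integrable_EFinZ.
- exact: above_le_powR.
Qed.

Lemma powR_le_dyadic_sum r c N (s : R) : 0 < r -> 0 < c ->
  7 * c < s -> s <= 7 * (c * 2 ^+ N) ->
  s `^ r <= 14 `^ r *
    \sum_(k < N) (c * 2 ^+ k) `^ r * (7 * (c * 2 ^+ k) < s)%R%:R.
Proof.
move=> r0 c0 cs; elim: N => [|N IH] sN.
  by rewrite expr0 mulr1 leNgt cs in sN.
have t0 : 0 < c * 2 ^+ N by rewrite mulr_gt0// exprn_gt0.
rewrite big_ord_recr/= mulrDr; have [{}sN|Ns] := leP s (7 * (c * 2 ^+ N)).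
  by rewrite mulr0 mulr0 addr0; exact: IH.
rewrite -[leLHS]add0r; apply: lerD.
  by rewrite mulr_ge0 ?powR_ge0// sumr_ge0// => k _; rewrite mulr_ge0 ?powR_ge0.
rewrite mulr1 -powRM ?(ltW t0)//; apply: powR_le; rewrite ?(ltW r0)//.
  by apply: ltW; apply: lt_trans cs; rewrite mulr_gt0.
by move: sN; rewrite exprS; lra.
Qed.

(** Only finite sums of levels enter the hypothesis, so that a bound for them can
    be found by integrating term by term.  The factor [14] combines the [7] with
    the ratio [2] of consecutive levels. *)
Lemma integral_powR_le_levels r h B : 0 < r -> measurable_fun setT h ->
  (forall x, 0 <= h x) -> (forall t, 0 < t -> integrable (fun x => (t < h x)%R%:R)) ->
  (forall N c, 0 < c ->
    \sum_(k < N) (c * 2 ^+ k) `^ r * level h (7 * (c * 2 ^+ k)) <= B) ->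
  (\int[mu]_x (h x `^ r)%:E <= (14 `^ r * B)%:E)%E.
Proof.
move=> r0 mh h0 ih HB.
pose F n := [set x | (7 / 2 ^+ n < h x <= 7 * 2 ^+ n)%R].
have mhr : measurable_fun setT (fun x => (h x `^ r)%:E).
  by apply/measurable_EFinP; exact: measurableT_comp (measurable_powR r) mh.
have mF n : measurable (F n).
  have : measurable_fun setT (fun x => (7 / 2 ^+ n < h x <= 7 * 2 ^+ n)%R).
    by apply: measurable_and; [exact: measurable_fun_ltr|exact: measurable_fun_ler].
  by move=> /(_ measurableT [set true] I); rewrite setTI.
have pow0 n : 0 < 2 ^+ n :> R by exact: exprn_gt0.
have Fnd : {homo F : n m / (n <= m)%N >-> (n <= m)%O}.
  move=> n m nm; apply/subsetPset => x; rewrite /F/= => /andP[h1 h2].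
  have nm2 : 2 ^+ n <= 2 ^+ m :> R by rewrite ler_eXn2l// ltr1n.
  apply/andP; split.
    by apply: le_lt_trans h1; rewrite ler_pM2l// lef_pV2 ?posrE.
  by apply: le_trans h2 _; rewrite ler_pM2l.
have cupF : \bigcup_n F n = [set x | 0 < h x].
  apply/seteqP; split=> x /=.
    by move=> [n _] /andP[h1 _]; apply: lt_trans h1; rewrite divr_gt0.
  move=> hx; have [n1 H1] := exists_div_expn2_lt 7 hx.
  have [n2 H2] := exists_div_expn2_lt (h x) (ltr0n R 7).
  exists (maxn n1 n2) => //; rewrite /F/=.
  have le1 : 2 ^+ n1 <= 2 ^+ maxn n1 n2 :> R by rewrite ler_eXn2l ?ltr1n// leq_maxl.
  have le2 : 2 ^+ n2 <= 2 ^+ maxn n1 n2 :> R by rewrite ler_eXn2l ?ltr1n// leq_maxr.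
  apply/andP; split.
    by apply: le_lt_trans H1; rewrite ler_pM2l// lef_pV2 ?posrE.
  by move: H2; rewrite ltr_pdivrMr// => /ltW/le_trans; apply; rewrite ler_pM2l.
have -> : (\int[mu]_x (h x `^ r)%:E = \int[mu]_(x in \bigcup_n F n) (h x `^ r)%:E)%E.
  rewrite [RHS]integral_mkcond; apply: eq_integral => x _.
  rewrite patchE cupF; case: ifPn => //; rewrite notin_setE/= => /negP.
  by rewrite -leNgt => hx; have -> : h x = 0; [apply/le_anti; rewrite hx h0|rewrite powR0// gt_eqF].
have cF : (\int[mu]_(x in F n) (h x `^ r)%:E)%E @[n --> \oo] -->
    (\int[mu]_(x in \bigcup_n F n) (h x `^ r)%:E)%E.
  apply: ge0_nondecreasing_set_cvg_integral => // [n|n x _].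
    exact: measurable_funTS.
  by rewrite lee_fin powR_ge0.
apply: (cvge_le _ cF).
apply: nearW => n; pose c : R := (2 ^+ n)^-1.
have c0 : 0 < c by rewrite invr_gt0.
have cn k : 0 < 7 * (c * 2 ^+ k) by rewrite !mulr_gt0// exprn_gt0.
pose G k x : R := (c * 2 ^+ k) `^ r * (7 * (c * 2 ^+ k) < h x)%R%:R.
have iGk k : integrable (G k) by apply: integrable_EFinZ; exact: ih.
have iG := integrable_EFin_sum (n + n) iGk.
have iG' := integrable_EFinZ (14 `^ r) iG.
have G0 x : 0 <= 14 `^ r * \sum_(k < n + n) G k x.
  by rewrite mulr_ge0 ?powR_ge0// sumr_ge0// => k _; rewrite mulr_ge0 ?powR_ge0.
have mG : measurable_fun setT (fun x => (14 `^ r * \sum_(k < n + n) G k x)%:E).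
  by have /integrableP[] := iG'.
apply: (@le_trans _ _ (\int[mu]_x (14 `^ r * \sum_(k < n + n) G k x)%:E)%E); last first.
  rewrite (integral_EFinE iG') (RintegralZl _ measurableT iG) lee_fin.
  rewrite ler_wpM2l ?powR_ge0// (Rintegral_sum (n + n) iGk).
  apply: le_trans (HB (n + n)%N c c0); rewrite le_eqVlt; apply/orP; left.
  by apply/eqP/eq_bigr => k _; rewrite RintegralZl//; exact: ih.
apply: (@le_trans _ _ (\int[mu]_(x in F n) (14 `^ r * \sum_(k < n + n) G k x)%:E)%E).
  apply: ge0_le_integral => //.
  - by move=> x _; rewrite lee_fin powR_ge0.
  - exact: measurable_funTS.
  - exact: measurable_funTS.
  - move=> x; rewrite /F/= => /andP[h1 h2]; rewrite lee_fin.
    apply: powR_le_dyadic_sum => //.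
    have -> : c * 2 ^+ (n + n) = 2 ^+ n.
      by rewrite exprD mulrA mulVf ?mul1r// gt_eqF.
    exact: h2.
by apply: ge0_subset_integral => // x _; rewrite lee_fin.
Qed.

End Levels.

(** * Interpolation *)

Section Interpolation.
Context {R : realType} {k : scalar_kind} {V : vectType (scalars R k)}.
Variable ip : {dot V for @sconj R k}.
Context {d : measure_display} {X : measurableType d}.
Variable mu : {measure set X -> \bar R}.
Variables (L2p : set (X -> V)) (hL2p : closed_subspace_L2 ip mu L2p).
Variables (p : R) (p1 : 1 < p).
Implicit Types (f g a : X -> V) (A : X -> bool).

Local Notation "`[ u ]" := (vnorm ip u) (format "`[ u ]").
Local Notation Ls := (Ls ip mu).
Local Notation npow := (npow ip mu).
Local Notation is_proj := (is_Lp_proj ip mu L2p p).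
Local Notation integrable h := (mu.-integrable setT (EFin \o h)).
Local Notation lev g := (level mu (fun x => `[g x])).

Let p0 : 0 < p. Proof. exact: lt_trans p1. Qed.

Lemma proj_Ls f a : is_proj f a -> Ls p a.
Proof. by case=> /Lsp_Ls. Qed.

Lemma Ls_measurable s g : 0 < s -> Ls s g -> measurable_fun setT (fun x => `[g x]).
Proof. by move=> s0 /(LsP ip mu g s0)[mg _]; exact: measurable_vnorm. Qed.

Lemma lev_integrable s g t : 0 < s -> 0 < t -> Ls s g ->
  integrable (fun x => (t < `[g x])%R%:R).
Proof.
move=> s0 t0 Lg; apply: (integrable_above s0 t0) (Ls_integrable s0 Lg).
  exact: Ls_measurable Lg.
by move=> x; exact: vnorm_ge0.
Qed.

Lemma lev_markov s g t : 0 < s -> 0 < t -> Ls s g ->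
  lev g t <= t `^ (- s) * npow s g.
Proof.
move=> s0 t0 Lg; apply: (level_markov s0 t0) (Ls_integrable s0 Lg).
  exact: Ls_measurable Lg.
by move=> x; exact: vnorm_ge0.
Qed.

(** Stability compares the distribution functions of [a] and [a']. *)
Lemma level_le_cut eta : 0 < eta -> exists2 C, 0 <= C &
  forall f A a a' t, Ls p f -> measurable_fun setT A -> is_proj f a ->
    is_proj (cut A f) a' -> 0 < t ->
    lev a (7 * t) <= lev a' t + lev f t + t `^ (- p) *
      \int[mu]_x ((A x)%:R * (eta * `[f x - a x] `^ p + C * `[f x] `^ p)).
Proof.
move=> eta0; have [c c0 Hc] := level_le_midgap ip p1.
have ec0 : 0 < eta / c by exact: divr_gt0.
have [C C0 HC] := proj_cut_stability hL2p p1 ec0.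
exists (c * C) => [|f A a a' t Lf mA Pa Pa' t0]; first by rewrite mulr_ge0// ltW.
have La := proj_Ls Pa; have La' := proj_Ls Pa'.
have Lcf : Ls p (cut A f) by exact: Ls_cut.
have t70 : 0 < 7 * t by rewrite mulr_gt0.
have ia7 := lev_integrable p0 t70 La; have ia := lev_integrable p0 t0 La'.
have fi := lev_integrable p0 t0 Lf.
have ig := integrable_midgap p1 (LsB p0 Lf La) (LsB p0 Lcf La').
have igc := integrable_EFinZ (t `^ (- p)) (integrable_EFinZ c ig).
have iaf := integrable_EFinD ia fi.
have step : lev a (7 * t) <= lev a' t + lev f t + t `^ (- p) *
    (c * \int[mu]_x midgap ip p (f x - a x) (cut A f x - a' x)).
  rewrite -(RintegralZl _ measurableT ig).
  rewrite -(RintegralZl _ measurableT (integrable_EFinZ c ig)).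
  rewrite -(RintegralD measurableT ia fi) -(RintegralD measurableT iaf igc).
  apply: Rintegral_le => [||x]; [exact: ia7|exact: (integrable_EFinD iaf igc)|].
  apply: Hc => //; rewrite /cut; case: (A x) => //.
  by rewrite vnorm0 vnorm_ge0.
apply: le_trans step _; rewrite lerD2l ler_wpM2l ?powR_ge0//.
apply: le_trans (ler_wpM2l (ltW c0) (HC _ _ _ _ Lf mA Pa Pa')) _.
have ib := Ls_integrable p0 (LsB p0 Lf La); have fi' := Ls_integrable p0 Lf.
have iA : integrable (fun x => (A x)%:R *
    (eta / c * `[f x - a x] `^ p + C * `[f x] `^ p)).
  apply: (integrable_mul_indb mA).
    by move=> x; apply: addr_ge0; apply: mulr_ge0; rewrite ?powR_ge0 ?(ltW ec0).
  exact: (integrable_EFinD (integrable_EFinZ _ ib) (integrable_EFinZ _ fi')).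
rewrite -(RintegralZl _ measurableT iA) le_eqVlt; apply/orP; left; apply/eqP.
by apply: eq_Rintegral => x _; field; rewrite gt_eqF.
Qed.

Variables (q r : R) (q0 : 0 < q) (r0 : 0 < r).
Hypotheses (rp : r - p != 0) (rq : r - q != 0).
Hypothesis between : (r - q < 0) = ~~ (r - p < 0).
Variables (Cq : R) (Cq0 : 0 <= Cq).
Hypothesis weak : forall f a, Ls p f -> Ls q f -> is_proj f a ->
  forall t, 0 < t -> lev a t <= Cq * t `^ (- q) * npow q f.

(** The set on which [f] is cut off at level [t]: it lies where
    [max |f| |f - a|] is below [t] if [r < p], and above [t] if [r > p].  That
    [|f - a|] enters is what makes the errors summable over the levels. *)
Definition cutset f a t : X -> bool :=
  fun x => summable_side (r - p) (Num.max `[f x] `[f x - a x]) t.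

Lemma measurable_cutset f a t : Ls p f -> Ls p a ->
  measurable_fun setT (cutset f a t).
Proof.
move=> Lf La.
have mM : measurable_fun setT (fun x => Num.max `[f x] `[f x - a x]).
  apply: measurable_maxr; first exact: Ls_measurable Lf.
  exact: Ls_measurable (LsB p0 Lf La).
by rewrite /cutset /summable_side; case: (r - p < 0);
  [exact: measurable_fun_ler|exact: measurable_fun_ltr].
Qed.

Lemma cut_cutset_Lq f a t : Ls p f -> Ls p a -> 0 < t ->
  Ls q (cut (cutset f a t) f).
Proof.
move=> Lf La t0; have mA := measurable_cutset t Lf La.
have mc : vmeasurable (cut (cutset f a t) f).
  by apply: (vmeasurable_cut ip mA); case: ((LsP ip mu f p0).1 Lf).
apply/LsP => //; split; first exact: mc.
have fi := Ls_integrable p0 Lf; have ib := Ls_integrable p0 (LsB p0 Lf La).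
apply: integrable_dominated (integrable_EFinZ (t `^ (q - p)) (integrable_EFinD fi ib)).
  exact: measurable_vnorm_powR.
move=> x; rewrite powR_ge0/=.
have rhs0 : 0 <= t `^ (q - p) * (`[f x] `^ p + `[f x - a x] `^ p).
  by rewrite mulr_ge0 ?addr_ge0 ?powR_ge0.
rewrite /cut; have [cx|cx] := boolP (cutset f a t x).
  by rewrite vnorm0 powR0// gt_eqF.
have f0 := vnorm_ge0 ip (f x).
have [fz|fz] := eqVneq `[f x] 0; first by rewrite {1}fz powR0 ?gt_eqF.
move: cx; rewrite /cutset -(summable_sideN _ _ between).
set M := Num.max _ _ => cx.
have fM : `[f x] <= M by rewrite le_max lexx.
have M0 : 0 < M by apply: lt_le_trans fM; rewrite lt_def fz.
have MM : M `^ p <= `[f x] `^ p + `[f x - a x] `^ p.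
  rewrite /M; case: (leP `[f x] `[f x - a x]) => _; first by rewrite lerDr powR_ge0.
  by rewrite lerDl powR_ge0.
apply: le_trans (powR_le (ltW q0) f0 fM) _.
rewrite -(powR_subK q p M0); apply: ler_pM => //; try exact: powR_ge0.
move: cx between; rewrite /summable_side.
have [rq0|rq0] := ltP (r - q) 0 => Mt /esym.
  move=> /negbTE; rewrite ltNge => /negbFE rp0.
  by apply: powR_le; rewrite ?(ltW M0)//; lra.
move=> /negbFE rp0; rewrite -(opprB p q) !powRN lef_pV2 ?posrE ?powR_gt0//.
by apply: powR_le; rewrite ?(ltW t0) ?(ltW Mt)//; lra.
Qed.

Lemma integrable_level_term f a eta C t : 0 <= eta -> 0 <= C ->
  Ls p f -> Ls p a -> 0 < t ->
  integrable (fun x => level_term p q r Cq eta C `[f x] `[f x - a x] t) /\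
  \int[mu]_x level_term p q r Cq eta C `[f x] `[f x - a x] t =
    Cq * (t `^ (r - q) * npow q (cut (cutset f a t) f)) + t `^ r * lev f t +
    t `^ (r - p) * \int[mu]_x ((cutset f a t x)%:R *
      (eta * `[f x - a x] `^ p + C * `[f x] `^ p)).
Proof.
move=> eta0 C0 Lf La t0; have mA := measurable_cutset t Lf La.
have E x : (~~ cutset f a t x)%:R * `[f x] `^ q = `[cut (cutset f a t) f x] `^ q.
  rewrite /cut; case: (cutset _ _ _ _); last by rewrite mul1r.
  by rewrite mul0r vnorm0 powR0// gt_eqF.
have i1 : integrable (fun x => (~~ cutset f a t x)%:R * `[f x] `^ q).
  under eq_fun do rewrite E; exact: (Ls_integrable q0 (cut_cutset_Lq Lf La t0)).
have i2 := lev_integrable p0 t0 Lf.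
have ib := Ls_integrable p0 (LsB p0 Lf La); have fi := Ls_integrable p0 Lf.
have i3 : integrable (fun x => (cutset f a t x)%:R *
    (eta * `[f x - a x] `^ p + C * `[f x] `^ p)).
  apply: (integrable_mul_indb mA).
    by move=> x; rewrite addr_ge0 ?mulr_ge0 ?powR_ge0.
  exact: (integrable_EFinD (integrable_EFinZ _ ib) (integrable_EFinZ _ fi)).
have j1' := integrable_EFinZ (t `^ (r - q)) i1.
have j1 := integrable_EFinZ Cq j1'.
have j2 := integrable_EFinZ (t `^ r) i2.
have j3 := integrable_EFinZ (t `^ (r - p)) i3.
split; first exact: (integrable_EFinD (integrable_EFinD j1 j2) j3).
rewrite /level_term (RintegralD measurableT (integrable_EFinD j1 j2) j3).
rewrite (RintegralD measurableT j1 j2).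
rewrite (RintegralZl _ measurableT j1') (RintegralZl _ measurableT i1).
rewrite (RintegralZl _ measurableT i2) (RintegralZl _ measurableT i3).
congr (_ * (_ * _) + _ + _); by apply: eq_Rintegral => x _; exact: E.
Qed.

Lemma level_le_level_term eta : 0 < eta -> exists2 C, 0 <= C &
  forall f a t, Ls p f -> is_proj f a -> 0 < t ->
    t `^ r * lev a (7 * t) <=
    \int[mu]_x level_term p q r Cq eta C `[f x] `[f x - a x] t.
Proof.
move=> eta0; have [C C0 HC] := level_le_cut eta0; exists C => // f a t Lf Pa t0.
have La := proj_Ls Pa; have mA := measurable_cutset t Lf La.
have Lcf : Ls p (cut (cutset f a t) f) by exact: Ls_cut.
have [a' Pa'] := Lp_proj_exists hL2p p1 Lcf.
have [_ ->] := integrable_level_term (ltW eta0) C0 Lf La t0.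
have w := weak Lcf (cut_cutset_Lq Lf La t0) Pa' t0.
have h := HC f _ a a' t Lf mA Pa Pa' t0.
apply: le_trans (ler_wpM2l (powR_ge0 t r) h) _.
move: w; move: (npow q _) (lev a' t) (lev f t) (\int[mu]_x _) => N W F J w.
rewrite !(powRD_pos _ _ t0) !mulrDr; apply: lerD; last by rewrite mulrA.
rewrite lerD2r; apply: le_trans (ler_wpM2l (powR_ge0 t r) w) _.
by rewrite le_eqVlt; apply/orP; left; apply/eqP; ring.
Qed.

(** Here [a] is in [L^p] and in weak [L^q], and [r] lies strictly between [p] and
    [q]: one of the two decay rates is used below level [1], the other above. *)
Lemma proj_Lr_of_Lq f a : Ls p f -> Ls q f -> is_proj f a -> Ls r a.
Proof.
move=> Lf Lqf Pa; have La := proj_Ls Pa.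
have [D1 D10 H1] := sum_dyadic_powR rq; have [D3 D30 H3] := sum_dyadic_powR rp.
have K1 : 0 <= Cq * npow q f by rewrite mulr_ge0 ?npow_ge0.
have K3 : 0 <= npow p a by exact: npow_ge0.
have mono g t : Ls p g -> 0 < t -> lev g (7 * t) <= lev g t.
  move=> Lg t0; have t70 : 0 < 7 * t by rewrite mulr_gt0.
  apply: Rintegral_le => [||x].
  - exact: (lev_integrable p0 t70 Lg).
  - exact: (lev_integrable p0 t0 Lg).
  - have [h|_] := ltP (7 * t); last by rewrite ler0n.
    by rewrite (_ : t < _)//; apply: lt_trans h; rewrite ltr_pMl// ltr1n.
have lev_le t : 0 < t -> t `^ r * lev a (7 * t) <=
    Cq * npow q f * (t `^ (r - q) * (summable_side (r - q) 1 t)%:R) +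
    npow p a * (t `^ (r - p) * (summable_side (r - p) 1 t)%:R).
  move=> t0; apply: le_trans (ler_wpM2l (powR_ge0 t r) (mono _ _ La t0)) _.
  rewrite (summable_sideN _ _ between); case: (summable_side _ _ _) => /=.
    rewrite !mulr0 add0r mulr1 powRD_pos// mulrCA ler_wpM2l ?powR_ge0// mulrC.
    exact: lev_markov.
  rewrite !mulr0 addr0 mulr1 powRD_pos// mulrCA ler_wpM2l ?powR_ge0//.
  by apply: le_trans (weak Lf Lqf Pa t0) _; rewrite mulrAC.
have mna : measurable_fun setT (fun x => `[a x]) by exact: Ls_measurable La.
have na0 x : 0 <= `[a x] by exact: vnorm_ge0.
have ia t : 0 < t -> integrable (fun x => (t < `[a x])%R%:R).
  by move=> t0; exact: (lev_integrable p0 t0 La).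
have := integral_powR_le_levels r0 mna na0 ia (B := Cq * npow q f * D1 + npow p a * D3).
move=> fin; apply/LsP => //; split; first by case: ((LsP ip mu a p0).1 La).
apply/integrable_ge0P.
- by apply: measurable_vnorm_powR; case: ((LsP ip mu a p0).1 La).
- by move=> x; exact: powR_ge0.
apply: le_lt_trans (fin _) (ltry _) => N c c0.
have t0 j : 0 < c * 2 ^+ j by rewrite mulr_gt0// exprn_gt0.
apply: le_trans (ler_sum _ (fun (j : 'I_N) _ => lev_le _ (t0 j))) _.
rewrite big_split/= -!mulr_sumr; apply: lerD; apply: ler_wpM2l => //.
  by have := H1 N c 1 c0 ltr01; rewrite powR1 mulr1.
by have := H3 N c 1 c0 ltr01; rewrite powR1 mulr1.
Qed.

(** The a priori estimate: the part of the bound that involves [f - a] is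
    absorbed into the left side, which is why [a] has to be in [L^r]. *)
Lemma npow_proj_le_of_Lr : exists2 K, 0 <= K & forall f a,
  Ls p f -> Ls r f -> is_proj f a -> Ls r a -> npow r a <= K * npow r f.
Proof.
have c14 : 0 < 14 `^ r :> R by exact: powR_gt0.
have c2 : 0 < 2 `^ r :> R by exact: powR_gt0.
pose kappa := (2 * (14 `^ r * 2 `^ r))^-1 : R.
have k0 : 0 < kappa by rewrite invr_gt0 !mulr_gt0.
have ke : 14 `^ r * kappa * 2 `^ r = 2^-1.
  by rewrite /kappa; field; rewrite !gt_eqF.
clearbody kappa.
have [eta eta0 Heta] := sum_level_term_le p0 q0 r0 rp rq between Cq0 k0.
have [C C0 HC] := level_le_level_term eta0.
have [C' C'0 HC'] := Heta C C0.
exists (1 + 2 * (14 `^ r * C')) => [|f a Lf Lrf Pa Lra].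
  by rewrite addr_ge0// !mulr_ge0// ltW.
have La := proj_Ls Pa.
have irb := Ls_integrable r0 (LsB r0 Lrf Lra); have irf := Ls_integrable r0 Lrf.
have jb := integrable_EFinZ kappa irb; have jf := integrable_EFinZ C' irf.
have S N c : 0 < c -> \sum_(k < N) (c * 2 ^+ k) `^ r * lev a (7 * (c * 2 ^+ k))
    <= kappa * npow r (f \- a) + C' * npow r f.
  move=> c0; have t0 j : 0 < c * 2 ^+ j by rewrite mulr_gt0// exprn_gt0.
  apply: le_trans (ler_sum _ (fun (j : 'I_N) _ => HC f a _ Lf Pa (t0 j))) _.
  pose T (j : nat) x := level_term p q r Cq eta C `[f x] `[f x - a x] (c * 2 ^+ j).
  have iT j : integrable (T j).
    exact: (integrable_level_term (ltW eta0) C0 Lf La (t0 j)).1.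
  rewrite -(Rintegral_sum N iT).
  rewrite -(RintegralZl _ measurableT irb) -(RintegralZl _ measurableT irf).
  rewrite -(RintegralD measurableT jb jf).
  apply: Rintegral_le => [||x].
  - exact: (integrable_EFin_sum N iT).
  - exact: (integrable_EFinD jb jf).
  - exact: (HC' N c _ _ c0 (vnorm_ge0 _ _) (vnorm_ge0 _ _)).
have := integral_powR_le_levels r0 (Ls_measurable p0 La) (fun x => vnorm_ge0 ip (a x))
  (fun t t0 => lev_integrable p0 t0 La) S.
rewrite (npow_EFin r0 Lra) lee_fin.
have h : npow r (f \- a) <= 2 `^ r * (npow r f + npow r a).
  rewrite -(RintegralD measurableT irf (Ls_integrable r0 Lra)).
  rewrite -(RintegralZl _ measurableT (integrable_EFinD irf (Ls_integrable r0 Lra))).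
  apply: Rintegral_le => [||x].
  - exact: irb.
  - exact: (integrable_EFinZ _ (integrable_EFinD irf (Ls_integrable r0 Lra))).
  apply: le_trans (powRD_le2 (ltW r0) (vnorm_ge0 _ _) (vnorm_ge0 _ _)).
  by apply: powR_le; rewrite ?(ltW r0) ?vnorm_ge0 ?ler_vnormB.
move: h; move: (npow r (f \- a)) (npow r f) (npow r a) => B F A hB hA.
have h1 : 14 `^ r * (kappa * B) <= 2^-1 * (F + A).
  rewrite -ke -!mulrA; apply: ler_wpM2l; first exact: ltW.
  by apply: ler_wpM2l; first exact: ltW.
by move: hA; rewrite mulrDr; lra.
Qed.

(** By dominated convergence: as [t] tends to [0], if [r < p], the sets shrink to
    the common zeros of [f] and [f - a], and as [t] tends to infinity, if
    [r > p], they shrink to the empty set. *)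
Lemma cutset_error_small f a C e : Ls p f -> Ls p a -> 0 <= C -> 0 < e ->
  exists2 t, 0 < t & \int[mu]_x ((cutset f a t x)%:R *
      (1 * `[f x - a x] `^ p + C * `[f x] `^ p)) < e.
Proof.
move=> Lf La C0 e0.
pose tau n : R := if r - p < 0 then 1 / 2 ^+ n else 2 ^+ n.
have pow0 n : 0 < 2 ^+ n :> R by exact: exprn_gt0.
have tau0 n : 0 < tau n by rewrite /tau; case: ifP => _; rewrite ?divr_gt0.
pose G x : R := 1 * `[f x - a x] `^ p + C * `[f x] `^ p.
have ib := Ls_integrable p0 (LsB p0 Lf La); have fi := Ls_integrable p0 Lf.
have iG : integrable G.
  exact: (integrable_EFinD (integrable_EFinZ _ ib) (integrable_EFinZ _ fi)).
have G0 x : 0 <= G x by rewrite addr_ge0 ?mulr_ge0 ?powR_ge0.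
have mA n := measurable_cutset (tau n) Lf La.
pose g n x : R := (cutset f a (tau n) x)%:R * G x.
have ig n : integrable (g n) by exact: (integrable_mul_indb (mA n) G0 iG).
have g_cvg x : (g n x)%:E @[n --> \oo] --> 0%:E.
  suff [n0 Hn0] : exists n0, forall n, (n0 <= n)%N -> g n x = 0.
    apply: cvg_near_cst; exists n0 => // n /= n0n.
    by rewrite Hn0.
  have two_le n m : (n <= m)%N -> 2 ^+ n <= 2 ^+ m :> R.
    by move=> nm; rewrite ler_eXn2l// ltr1n.
  rewrite /g /cutset /summable_side /tau; set M := Num.max _ _.
  case: (r - p < 0).
    have [M0|M0] := leP M 0.
      have /andP[] : (`[f x] <= 0) && (`[f x - a x] <= 0).
        by move: M0; rewrite ge_max.
      have fz : `[f x] <= 0 -> `[f x] = 0.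
        by move=> h; apply/le_anti; rewrite h vnorm_ge0.
      have bz : `[f x - a x] <= 0 -> `[f x - a x] = 0.
        by move=> h; apply/le_anti; rewrite h vnorm_ge0.
      move=> /fz fx0 /bz bx0; exists 0%N => n _.
      by rewrite /G fx0 bx0 powR0 ?gt_eqF// !(mulr0, addr0).
    have [n0 Hn0] := exists_div_expn2_lt 1 M0; exists n0 => n n0n.
    rewrite leNgt (le_lt_trans _ Hn0) ?mul0r//.
    by rewrite ler_pM2l// lef_pV2 ?posrE// two_le.
  have [n0 Hn0] := exists_div_expn2_lt M ltr01; exists n0 => n n0n.
  move: Hn0; rewrite ltr_pdivrMr// mul1r => /ltW/le_trans/(_ (two_le _ _ n0n)).
  by rewrite leNgt => /negbTE ->; rewrite mul0r.
have := @dominated_cvg _ X R mu setT measurableT (fun n x => (g n x)%:E) (fun=> 0%:E)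
  (EFin \o G).
have mg n : measurable_fun setT (fun x => (g n x)%:E).
  by have /integrableP[] := ig n.
have Gfin x : setT x -> (EFin \o G) x \is a fin_num by [].
have gG n x : setT x -> (`|(g n x)%:E| <= (EFin \o G) x)%E.
  move=> _; rewrite /= lee_fin ger0_norm; last by rewrite mulr_ge0.
  by rewrite /g; case: (cutset _ _ _ _); rewrite ?mul1r ?mul0r.
move=> /(_ mg (fun x _ => g_cvg x) Gfin iG gG).
rewrite integral0 => /fine_cvgP[_ /cvgrPdist_lt/(_ e e0)[n _ /(_ n (leqnn n))]].
rewrite /= sub0r normrN => h; exists (tau n) => //.
exact: le_lt_trans (ler_norm _) h.
Qed.

Lemma sum_lev_le : exists2 D, 0 <= D & forall g N c, Ls r g -> 0 < c ->
  \sum_(j < N) (c * 2 ^+ j) `^ r * lev g (c * 2 ^+ j) <= D * npow r g.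
Proof.
have [D D0 HD] := sum_dyadic_above r0; exists D => // g N c Lg c0.
have t0 j : 0 < c * 2 ^+ j by rewrite mulr_gt0// exprn_gt0.
have ig j := lev_integrable r0 (t0 j) Lg.
have ig' j := integrable_EFinZ ((c * 2 ^+ j) `^ r) (ig j).
have irg := Ls_integrable r0 Lg.
have e j : (c * 2 ^+ j) `^ r * lev g (c * 2 ^+ j) =
    \int[mu]_x ((c * 2 ^+ j) `^ r * (c * 2 ^+ j < `[g x])%R%:R).
  by rewrite (RintegralZl _ measurableT (ig j)).
under eq_bigr do rewrite e.
rewrite -(Rintegral_sum N ig') -(RintegralZl _ measurableT irg).
apply: Rintegral_le => [||x].
- exact: (integrable_EFin_sum N ig').
- exact: (integrable_EFinZ _ irg).
- exact: (HD N c _ c0 (vnorm_ge0 _ _)).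
Qed.

(** Cutting [f] once puts it into [L^q], so that the projection of the cut
    function is in [L^r] and obeys the a priori estimate; for finitely many
    levels the error of the cut is negligible. *)
Lemma Lp_proj_strong_type : exists K, forall f a,
  Ls p f -> Ls r f -> is_proj f a ->
  (\int[mu]_x (`[a x] `^ r)%:E <= (K * npow r f)%:E)%E.
Proof.
have [K K0 HK] := npow_proj_le_of_Lr.
have [C C0 HC] := level_le_cut ltr01; have [D D0 HD] := sum_lev_le.
exists (14 `^ r * (D * K + D)) => f a Lf Lrf Pa.
have La := proj_Ls Pa; rewrite -mulrA.
apply: (integral_powR_le_levels r0 (Ls_measurable p0 La)
  (fun x => vnorm_ge0 ip (a x)) (fun t t0 => lev_integrable p0 t0 La)) => N c c0.
have t0 j : 0 < c * 2 ^+ j by rewrite mulr_gt0// exprn_gt0.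
apply/ler_addgt0Pr => e e0.
pose W := \sum_(j < N) (c * 2 ^+ j) `^ r * (c * 2 ^+ j) `^ (- p).
have W0 : 0 <= W by apply: sumr_ge0 => j _; rewrite mulr_ge0 ?powR_ge0.
have e1 : 0 < e / (W + 1) by rewrite divr_gt0// ltr_wpDl.
have [tau tau0 err] := cutset_error_small Lf La C0 e1.
have mA := measurable_cutset tau Lf La.
have Lcf : Ls p (cut (cutset f a tau) f) by exact: Ls_cut.
have Lrcf : Ls r (cut (cutset f a tau) f) by exact: Ls_cut.
have Lqcf := cut_cutset_Lq Lf La tau0.
have [a' Pa'] := Lp_proj_exists hL2p p1 Lcf.
have Lra' := proj_Lr_of_Lq Lcf Lqcf Pa'.
have na' := HK _ _ Lcf Lrcf Pa' Lra'.
have ncf : npow r (cut (cutset f a tau) f) <= npow r f.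
  apply: Rintegral_le => [||x].
  - exact: (Ls_integrable r0 Lrcf).
  - exact: (Ls_integrable r0 Lrf).
  - apply: powR_le; rewrite ?(ltW r0) ?vnorm_ge0// /cut.
    by case: (cutset _ _ _ _); rewrite ?vnorm0 ?vnorm_ge0.
have sa' := HD a' N c Lra' c0; have sf := HD f N c Lrf c0.
move: err; set I := \int[mu]_x _ => err.
have step (j : 'I_N) : true -> (c * 2 ^+ j) `^ r * lev a (7 * (c * 2 ^+ j)) <=
    (c * 2 ^+ j) `^ r * lev a' (c * 2 ^+ j) +
    (c * 2 ^+ j) `^ r * lev f (c * 2 ^+ j) +
    (c * 2 ^+ j) `^ r * (c * 2 ^+ j) `^ (- p) * I.
  move=> _; rewrite -mulrA -!mulrDr ler_wpM2l ?powR_ge0//.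
  exact: (HC f _ a a' _ Lf mA Pa Pa' (t0 j)).
apply: le_trans (ler_sum _ step) _; rewrite !big_split/= -mulr_suml -/W.
have WI : W * I <= e.
  apply: (@le_trans _ _ (W * (e / (W + 1)))); first by rewrite ler_wpM2l// ltW.
  by rewrite mulrA ler_pdivrMr ?ltr_wpDl// mulrC ler_wpM2l ?(ltW e0)// lerDl.
apply: lerD; last exact: WI.
rewrite mulrDl; apply: lerD; last exact: sf.
apply: (le_trans sa'); rewrite -mulrA; apply: (ler_wpM2l D0).
exact: (le_trans na' (ler_wpM2l K0 ncf)).
Qed.

End Interpolation.

Section WeakTypeInterpolation.
Context {R : realType} {k : scalar_kind} {V : vectType (scalars R k)}.
Variable ip : {dot V for @sconj R k}.
Context {d : measure_display} {X : measurableType d}.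
Variable mu : {measure set X -> \bar R}.
Variables (L2p : set (X -> V)) (hL2p : closed_subspace_L2 ip mu L2p).
Variables (p : R) (p1 : 1 < p).

Local Notation "`[ u ]" := (vnorm ip u) (format "`[ u ]").
Local Notation Ls := (Ls ip mu).
Local Notation npow := (npow ip mu).
Local Notation is_proj := (is_Lp_proj ip mu L2p p).

Let p0 : 0 < p. Proof. exact: lt_trans p1. Qed.

Lemma npow_proj_le f a : Ls p f -> is_proj f a ->
  npow p a <= 2 `^ p * 2 * npow p f.
Proof.
move=> Lf /(is_Lp_projP L2p p1 a Lf)[Sa Ha].
have La := Lsp_Ls Sa; have L0 := Lsp_Ls (Lsp0 hL2p p1).
have f0 : npow p (f \- fun=> 0) = npow p f.
  by apply: eq_Rintegral => x _; rewrite /= subr0.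
have a0 : npow p (a \- fun=> 0) = npow p a.
  by apply: eq_Rintegral => x _; rewrite /= subr0.
have fa : npow p (a \- f) = npow p (f \- a).
  by apply: eq_Rintegral => x _; rewrite vdistC.
have := npowB_le p0 La Lf L0; rewrite a0 f0 fa => h.
have fA : npow p (f \- a) <= npow p f.
  by rewrite -[leRHS]f0; exact: (Ha _ (Lsp0 hL2p p1)).
move: h fA; move: (npow p (f \- a)) (npow p f) (npow p a) => B F A h BF.
apply: (le_trans h); rewrite -mulrA; apply: (ler_wpM2l (powR_ge0 2 p)).
by rewrite mulr2n mulrDl mul1r lerD2r.
Qed.

Lemma weak_type_level q C f a : 0 < q -> Ls q f -> is_proj f a ->
  (forall t, 0 < t -> (mu [set x | (t < `[a x])%R] <=
    (C * t `^ (- q))%:E * \int[mu]_x (`[f x] `^ q)%:E)%E) ->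
  forall t, 0 < t -> level mu (fun x => `[a x]) t <= `|C| * t `^ (- q) * npow q f.
Proof.
move=> q0 Lqf Pa H t t0; have La := proj_Ls Pa.
have := H t t0; rewrite (npow_EFin q0 Lqf) -EFinM.
rewrite (measure_Rintegral _ (lev_integrable p0 t0 La)); last first.
  by apply: measurable_above; exact: (Ls_measurable p0 La).
rewrite lee_fin => /le_trans; apply; apply: ler_wpM2r; first exact: npow_ge0.
by apply: ler_wpM2r; [exact: powR_ge0|exact: ler_norm].
Qed.

End WeakTypeInterpolation.

Theorem theorem1p1 (R : realType) (k : scalar_kind)
    (V : vectType (scalars R k)) (ip : {dot V for @sconj R k})
    (d : measure_display) (X : measurableType d)
    (mu : {sigma_finite_measure set X -> \bar R})
    (L2p : set (X -> V)) (hL2p : closed_subspace_L2 ip mu L2p)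
    (s1 : R) (soo : \bar R)
    (hs1 : 1 <= s1) (hs12 : s1 < 2) (hsoo : (2%:E < soo)%E)
    (hPi : forall s : R, s1 < s -> (s%:E < soo)%E ->
       orth_proj_extends ip mu L2p s)
    (p : R) (hp1 : s1 < p) (hpoo : (p%:E < soo)%E)
    (r1 r2 : R) (hr1 : s1 <= r1) (hr12 : r1 < r2) (hr2 : (r2%:E <= soo)%E)
    (hweak : forall ri : R, ri = r1 \/ ri = r2 ->
       exists Ci : R, forall f Rpf : X -> V,
         Ls ip mu p f -> Ls ip mu ri f -> is_Lp_proj ip mu L2p p f Rpf ->
         forall t : R, 0 < t ->
           (mu [set x | (t < vnorm ip (Rpf x))%R] <=
            (Ci * t `^ (- ri))%:E * \int[mu]_x (vnorm ip (f x) `^ ri)%:E)%E) :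
  forall r : R, r1 < r -> r < r2 ->
    exists Cr : R, forall f Rpf : X -> V,
      Ls ip mu p f -> Ls ip mu r f -> is_Lp_proj ip mu L2p p f Rpf ->
      (\int[mu]_x (vnorm ip (Rpf x) `^ r)%:E <=
       Cr%:E * \int[mu]_x (vnorm ip (f x) `^ r)%:E)%E.
Proof.
move=> r rr1 rr2.
have p1 : 1 < p by apply: le_lt_trans hp1.
have p0 : 0 < p by exact: lt_trans p1.
have r10 : 0 < r1 by apply: lt_le_trans hr1; exact: lt_le_trans hs1.
have r0 : 0 < r by exact: lt_trans rr1.
have r20 : 0 < r2 by exact: lt_trans rr2.
have conclude K : (forall f a, Ls ip mu p f -> Ls ip mu r f ->
    is_Lp_proj ip mu L2p p f a ->
    (\int[mu]_x (vnorm ip (a x) `^ r)%:E <= (K * npow ip mu r f)%:E)%E) ->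
  exists Cr : R, forall f Rpf : X -> V,
    Ls ip mu p f -> Ls ip mu r f -> is_Lp_proj ip mu L2p p f Rpf ->
    (\int[mu]_x (vnorm ip (Rpf x) `^ r)%:E <=
     Cr%:E * \int[mu]_x (vnorm ip (f x) `^ r)%:E)%E.
  move=> HK; exists K => f a Lf Lrf Pa.
  by rewrite (npow_EFin r0 Lrf) -EFinM; exact: HK.
have [rp|rp] := eqVneq r p.
  apply: (conclude (2 `^ p * 2)) => f a Lf _ Pa; rewrite rp.
  rewrite (npow_EFin p0 (proj_Ls Pa)) lee_fin; exact: (npow_proj_le hL2p p1 Lf Pa).
have interp q : q = r1 \/ q = r2 -> 0 < q -> r - q != 0 ->
    (r - q < 0) = ~~ (r - p < 0) -> exists K : R, forall f a,
    Ls ip mu p f -> Ls ip mu r f -> is_Lp_proj ip mu L2p p f a ->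
    (\int[mu]_x (vnorm ip (a x) `^ r)%:E <= (K * npow ip mu r f)%:E)%E.
  move=> /hweak[C HC] q0 rq opp.
  have rp' : r - p != 0 by rewrite subr_eq0.
  apply: (Lp_proj_strong_type hL2p p1 q0 r0 rp' rq opp (normr_ge0 C)).
  move=> f a Lf Lqf Pa; apply: (weak_type_level p1 q0 Lqf Pa).
  exact: (HC f a Lf Lqf Pa).
have [rltp|plr] := ltP r p.
  have [||||K HK] := interp r1; last exact: (conclude K HK).
  - by left.
  - exact: r10.
  - by rewrite subr_eq0 gt_eqF.
  - by rewrite !subr_lt0 rltp ltNge (ltW rr1).
have [||||K HK] := interp r2; last exact: (conclude K HK).
- by right.
- exact: r20.
- by rewrite subr_eq0 lt_eqF.
- by rewrite !subr_lt0 rr2 ltNge plr.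
Qed.
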